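(* Let $\varphi:\mathbb{D}\to\mathbb{D}$ be a non-elliptic holomorphic self-map. Then the following conditions are equivalent: (1) $\varphi$ is parabolic of zero hyperbolic step; (2) there exists $z_0\in\mathbb{D}$ with $(\varphi^{\circ n})'(z_0)\neq0$ for all $n\in\mathbb{N}$ such that $$\lim_{n\to+\infty}\frac{(\varphi^{\circ n})'(z_0)}{1-|\varphi^{\circ n}(z_0)|^2}=0;$$ (3) the equality $$\lim_{n\to+\infty}\frac{(\varphi^{\circ n})'(z_0)}{1-|\varphi^{\circ n}(z_0)|^2}=0$$ holds for all $z_0\in\mathbb{D}$.
   Context: $\mathbb{D}=\{z\in\mathbb{C}:|z|<1\}$, and $\rho_{\mathbb{D}}$ denotes the hyperbolic distance in $\mathbb{D}$. $\varphi^{\circ n}$ is the $n$-th iterate of $\varphi$. A holomorphic self-map of $\mathbb{D}$ is non-elliptic if it has no fixed point in $\mathbb{D}$; then its iterates converge locally uniformly to a point $\tau\in\partial\mathbb{D}$ (its Denjoy–Wolff point), and the angular derivative $\varphi'(\tau)$ exists and lies in $(0,1]$. It is parabolic if $\varphi'(\tau)=1$. It is of zero hyperbolic step if $\lim_{n\to\infty}\rho_{\mathbb{D}}(\varphi^{\circ n}(z),\varphi^{\circ(n+1)}(z))=0$ for some (equivalently, all) $z\in\mathbb{D}$. *)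

(* Defs.v *)
From Stdlib Require Export Reals.
From Coquelicot Require Export Coquelicot.

Open Scope R_scope.

Definition unit_disc (z : C) : Prop := Cmod z < 1.

(* Functions on the disc are total functions on C; only their values on the
   disc matter. The disc is open, so complex derivatives at its points are
   unaffected by values taken outside. *)
Definition holomorphic_on (D : C -> Prop) (f : C -> C) : Prop :=
  forall z : C, D z -> @ex_derive C_AbsRing C_NormedModule f z.

Definition holomorphic_self_map (phi : C -> C) : Prop :=
  (forall z : C, unit_disc z -> unit_disc (phi z)) /\
  holomorphic_on unit_disc phi.

Definition non_elliptic (phi : C -> C) : Prop :=
  ~ exists z : C, unit_disc z /\ phi z = z.

(* Poincare distance for the metric |dz| / (1 - |z|^2), of curvature -4. *)
Definition hyp_dist (z w : C) : R :=
  let t := Cmod ((z - w) / (1 - Cconj w * z))%C in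
  / 2 * ln ((1 + t) / (1 - t)).

Definition locally_uniform_lim
    (D : C -> Prop) (f : nat -> C -> C) (g : C -> C) : Prop :=
  forall z : C, D z ->
    exists U : C -> Prop, locally z U /\
      forall eps : posreal,
        eventually (fun n => forall w : C, D w -> U w ->
                      Cmod (f n w - g w)%C < eps).

Definition denjoy_wolff_point (phi : C -> C) (tau : C) : Prop :=
  Cmod tau = 1 /\
  locally_uniform_lim unit_disc (fun n => Nat.iter n phi) (fun _ => tau).

(* Non-tangential approach region of aperture M at tau; empty for M <= 1. *)
Definition stolz_region (tau : C) (M : R) (z : C) : Prop :=
  unit_disc z /\ Cmod (tau - z)%C < M * (1 - Cmod z).

Definition is_angular_lim (f : C -> C) (tau l : C) : Prop :=
  forall M : R, 1 < M ->
    filterlim f (within (stolz_region tau M) (locally tau)) (locally l).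

(* sigma is the angular boundary value phi(tau). *)
Definition is_angular_derive (phi : C -> C) (tau d : C) : Prop :=
  exists sigma : C,
    is_angular_lim phi tau sigma /\
    is_angular_lim (fun z => (phi z - sigma) / (z - tau))%C tau d.

Definition parabolic (phi : C -> C) : Prop :=
  non_elliptic phi /\
  exists tau : C, denjoy_wolff_point phi tau /\ is_angular_derive phi tau 1.

Definition zero_hyperbolic_step (phi : C -> C) : Prop :=
  exists z : C, unit_disc z /\
    is_lim_seq (fun n => hyp_dist (Nat.iter n phi z) (Nat.iter (S n) phi z)) 0.

Definition distortion_ratio (phi : C -> C) (z : C) (n : nat) : C :=
  (C_derive (Nat.iter n phi) z / RtoC (1 - Cmod (Nat.iter n phi z) ^ 2))%C.

(* Main.v *)
(* Write d for the pseudo-hyperbolic distance, z_n for the orbit of z, and f^h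
   for the hyperbolic derivative, so that up to a constant the distortion ratio
   has modulus (phi^n)^h(z) = prod_(k<n) phi^h(z_k).  Applying Schwarz-Pick
   twice bounds the gap between y = d(f z, f a) / d(z, a) and f^h(a) by
   d(z, a) (1 - y f^h(a)).  Two consequences drive the proof.
   - If d(z_n, w_n) does not tend to 0, its successive ratios y_n satisfy
     sum (1 - y_n) < oo, hence sum (1 - phi^h(z_n)) < oo, and (phi^m)^h(z_N)
     stays away from 0 for some N.
   - If (phi^n)^h(a) >= c for all n, then phi^n contracts distances near a by a
     bounded factor only, so an orbit merging with that of a must meet it.
   Taking w = phi z, the first gives (2) => zero step.  With phi fixed-point
   free, the two together show that zero step at one point forces (phi^n)^h -> 0
   everywhere, which is (3).  For (3) => (2) a noncritical orbit comes from
   nested discs and the identity theorem.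
   Finally, a zero-step orbit tends to the boundary and replaces both normal
   families and fixed points of r phi in the Denjoy-Wolff theorem: Schwarz-Pick
   at the points z_n, passed to a cluster point tau, makes horodiscs at tau
   invariant, and Harnack's inequality for P o phi - P, P the Poisson kernel,
   gives angular derivative 1.
   Holomorphy means only complex differentiability, so the maximum principle
   is derived from Goursat's theorem in logarithmic coordinates. *)
Require Import Defs.
From Stdlib Require Import Lra Lia Psatz ClassicalEpsilon FunctionalExtensionality.

(** * Continuity and complex differentiability *)

(** A difference quotient of a map that is merely complex differentiable is known to be continuous
    at its centre, not differentiable there. This shapes the analysis: [near_holo] allows such
    isolated points, and circle means tolerate them because they use differentiability on a
    punctured disc and only continuity at its centre. The first Schwarz-Pick step is the maximum
    principle for the hyperbolic quotient q of f at a; the second applies Schwarz-Pick to q itself,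
    so its centre must avoid a and reaches it by continuity. The identity theorem comes from the
    same quotient, by dividing out the zero at a again and again.

    Fixed points are excluded in three places: when the orbits of z and f z meet, when an iterate is
    constant, and when a zero-step orbit has a cluster point inside the disc. Each of these would
    produce one. *)

Definition cont_at (f : C -> C) (p : C) : Prop :=
  forall eps : R, 0 < eps -> exists eta : R, 0 < eta /\
    forall z : C, Cmod (z - p) < eta -> Cmod (f z - f p) < eps.

(* Caratheodory's form of differentiability: the difference quotient extends
   continuously to p.  The rules of calculus become continuity statements, and
   the quotient k is the function to which the maximum principle is applied. *)
Definition diff_quot (f : C -> C) (p : C) (k : C -> C) : Prop :=
  cont_at k p /\ forall z : C, (f z - f p = k z * (z - p))%C.

Definition diff_at (f : C -> C) (p : C) : Prop := exists k : C -> C, diff_quot f p k.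

Lemma Cminus_0_eq (a b : C) : Cmod (a - b) = 0 -> a = b.
Proof.
  intros H. apply Cmod_eq_0 in H.
  replace a with ((a - b) + b)%C by ring. rewrite H. ring.
Qed.

Lemma Cmod_minus_pos (a b : C) : a <> b -> 0 < Cmod (a - b).
Proof.
  intros H. destruct (Cmod_ge_0 (a - b)) as [h|h]; [exact h|].
  exfalso. apply H, Cminus_0_eq. now symmetry.
Qed.

Lemma Cmod_minus_sym (a b : C) : Cmod (a - b) = Cmod (b - a).
Proof. rewrite <- Cmod_opp. f_equal. ring. Qed.

Lemma Cmod_minus_triangle (a b c : C) : Cmod (a - c) <= Cmod (a - b) + Cmod (b - c).
Proof.
  replace (a - c)%C with ((a - b) + (b - c))%C by ring. apply Cmod_triangle.
Qed.

Lemma Cmod_triangle_rev (a b : C) : Cmod a - Cmod b <= Cmod (a - b).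
Proof.
  pose proof (Cmod_triangle (a - b) b) as H.
  replace (a - b + b)%C with a in H by ring. lra.
Qed.

Lemma cont_at_const (c p : C) : cont_at (fun _ => c) p.
Proof.
  intros eps He. exists 1. split; [lra|]. intros z _.
  replace (c - c)%C with (RtoC 0) by ring. now rewrite Cmod_0.
Qed.

Lemma cont_at_id (p : C) : cont_at (fun z => z) p.
Proof. intros eps He. exists eps. auto. Qed.

Lemma cont_at_plus (f g : C -> C) (p : C) :
  cont_at f p -> cont_at g p -> cont_at (fun z => f z + g z)%C p.
Proof.
  intros Hf Hg eps He.
  destruct (Hf (eps / 2)) as [e1 [H1 K1]]; [lra|].
  destruct (Hg (eps / 2)) as [e2 [H2 K2]]; [lra|].
  exists (Rmin e1 e2). split; [now apply Rmin_pos|]. intros z Hz.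
  replace (f z + g z - (f p + g p))%C with ((f z - f p) + (g z - g p))%C by ring.
  eapply Rle_lt_trans; [apply Cmod_triangle|].
  specialize (K1 z (Rlt_le_trans _ _ _ Hz (Rmin_l _ _))).
  specialize (K2 z (Rlt_le_trans _ _ _ Hz (Rmin_r _ _))). lra.
Qed.

Lemma cont_at_mult (f g : C -> C) (p : C) :
  cont_at f p -> cont_at g p -> cont_at (fun z => f z * g z)%C p.
Proof.
  intros Hf Hg eps He.
  pose proof (Cmod_ge_0 (f p)) as F0. pose proof (Cmod_ge_0 (g p)) as G0.
  set (K := Cmod (f p) + Cmod (g p) + 1).
  assert (HK : 0 < K) by (unfold K; lra).
  set (d := Rmin 1 (eps / (2 * K))).
  assert (Hd : 0 < d) by (apply Rmin_pos; [lra | apply Rdiv_lt_0_compat; lra]).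
  destruct (Hf d Hd) as [e1 [H1 K1]].
  destruct (Hg d Hd) as [e2 [H2 K2]].
  exists (Rmin e1 e2). split; [now apply Rmin_pos|]. intros z Hz.
  specialize (K1 z (Rlt_le_trans _ _ _ Hz (Rmin_l _ _))).
  specialize (K2 z (Rlt_le_trans _ _ _ Hz (Rmin_r _ _))).
  replace (f z * g z - f p * g p)%C
    with ((f z - f p) * (g z - g p) + (f p * (g z - g p) + g p * (f z - f p)))%C by ring.
  eapply Rle_lt_trans; [apply Cmod_triangle|].
  pose proof (Cmod_triangle (f p * (g z - g p)) (g p * (f z - f p))) as T.
  rewrite !Cmod_mult in *.
  assert (D1 : d <= 1) by apply Rmin_l.
  assert (D2 : d * (2 * K) <= eps).
  { apply Rle_trans with (eps / (2 * K) * (2 * K)).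
    - apply Rmult_le_compat_r; [lra | apply Rmin_r].
    - right. field. lra. }
  pose proof (Cmod_ge_0 (f z - f p)). pose proof (Cmod_ge_0 (g z - g p)).
  unfold K in *. nra.
Qed.

Lemma cont_at_ext_loc (f g : C -> C) (p : C) (r : R) :
  0 < r -> (forall z, Cmod (z - p) < r -> f z = g z) -> cont_at f p -> cont_at g p.
Proof.
  intros Hr E Hf eps He. destruct (Hf eps He) as [e [H1 H2]].
  exists (Rmin e r). split; [now apply Rmin_pos|]. intros z Hz.
  rewrite <- !E.
  - apply H2. eapply Rlt_le_trans; [exact Hz | apply Rmin_l].
  - replace (p - p)%C with (RtoC 0) by ring. now rewrite Cmod_0.
  - eapply Rlt_le_trans; [exact Hz | apply Rmin_r].
Qed.

Lemma cont_at_opp (f : C -> C) (p : C) : cont_at f p -> cont_at (fun z => - f z)%C p.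
Proof.
  intros Hf. apply cont_at_ext_loc with (f := fun z => (RtoC (-1) * f z)%C) (r := 1); [lra | |].
  - intros z _. apply injective_projections; simpl; ring.
  - apply cont_at_mult; [apply cont_at_const | exact Hf].
Qed.

Lemma cont_at_minus (f g : C -> C) (p : C) :
  cont_at f p -> cont_at g p -> cont_at (fun z => f z - g z)%C p.
Proof. intros Hf Hg. apply cont_at_plus; [exact Hf | now apply cont_at_opp]. Qed.

Lemma cont_at_neq (f : C -> C) (p : C) :
  cont_at f p -> f p <> 0 -> exists r, 0 < r /\
    forall z, Cmod (z - p) < r -> Cmod (f p) / 2 < Cmod (f z).
Proof.
  intros Hf H0. apply Cmod_gt_0 in H0.
  destruct (Hf (Cmod (f p) / 2)) as [e [H1 H2]]; [lra|].
  exists e. split; [exact H1|]. intros z Hz. specialize (H2 z Hz).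
  pose proof (Cmod_triangle_rev (f p) (f z)). rewrite Cmod_minus_sym in H2. lra.
Qed.

Lemma cont_at_inv (f : C -> C) (p : C) :
  cont_at f p -> f p <> 0 -> cont_at (fun z => / f z)%C p.
Proof.
  intros Hf H0 eps He.
  destruct (cont_at_neq f p Hf H0) as [r [Hr Hr']].
  assert (P : 0 < Cmod (f p)) by now apply Cmod_gt_0.
  destruct (Hf (eps * (Cmod (f p) * (Cmod (f p) / 2)))) as [e [H1 H2]].
  { repeat apply Rmult_lt_0_compat; lra. }
  exists (Rmin e r). split; [now apply Rmin_pos|]. intros z Hz.
  specialize (H2 z (Rlt_le_trans _ _ _ Hz (Rmin_l _ _))).
  specialize (Hr' z (Rlt_le_trans _ _ _ Hz (Rmin_r _ _))).
  assert (Hz0 : f z <> 0) by (apply Cmod_gt_0; lra).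
  replace (/ f z - / f p)%C with ((f p - f z) * / (f p * f z))%C by (field; auto).
  rewrite Cmod_mult, Cmod_inv, Cmod_mult by now apply Cmult_neq_0.
  rewrite (Cmod_minus_sym (f p)).
  apply Rmult_lt_reg_r with (Cmod (f p) * Cmod (f z)); [nra|].
  rewrite Rmult_assoc, Rinv_l by nra. rewrite Rmult_1_r.
  eapply Rlt_trans; [exact H2|].
  apply Rmult_lt_compat_l; [exact He|]. apply Rmult_lt_compat_l; lra.
Qed.

Lemma cont_at_div (f g : C -> C) (p : C) :
  cont_at f p -> cont_at g p -> g p <> 0 -> cont_at (fun z => f z / g z)%C p.
Proof. intros. apply cont_at_mult; [|apply cont_at_inv]; assumption. Qed.

Lemma cont_at_comp (f g : C -> C) (p : C) :
  cont_at f p -> cont_at g (f p) -> cont_at (fun z => g (f z)) p.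
Proof.
  intros Hf Hg eps He. destruct (Hg eps He) as [e [H1 H2]].
  destruct (Hf e H1) as [e' [H3 H4]]. exists e'. auto.
Qed.

(** A quotient known only near p extends to the whole plane: off the disc z differs from p, and the
    plain quotient serves. *)
Lemma diff_at_intro (f k : C -> C) (p : C) (r : R) :
  0 < r -> cont_at k p ->
  (forall z, Cmod (z - p) < r -> f z - f p = k z * (z - p))%C ->
  exists k', diff_quot f p k' /\ k' p = k p.
Proof.
  intros Hr Hk E.
  exists (fun z => if Rlt_dec (Cmod (z - p)) r then k z else ((f z - f p) / (z - p))%C).
  split; [split|].
  - apply cont_at_ext_loc with (f := k) (r := r); [exact Hr | | exact Hk].
    intros z Hz. destruct (Rlt_dec _ _); [reflexivity | contradiction].
  - intros z. destruct (Rlt_dec _ _) as [h|h]; [now apply E|].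
    field. intros H. apply h. rewrite H, Cmod_0. exact Hr.
  - destruct (Rlt_dec _ _) as [h|h]; [reflexivity|].
    exfalso. apply h. replace (p - p)%C with (RtoC 0) by ring. now rewrite Cmod_0.
Qed.

Lemma diff_at_loc (f k : C -> C) (p : C) (r : R) :
  0 < r -> cont_at k p ->
  (forall z, Cmod (z - p) < r -> f z - f p = k z * (z - p))%C -> diff_at f p.
Proof.
  intros Hr Hk E. destruct (diff_at_intro f k p r Hr Hk E) as [k' [H _]]. now exists k'.
Qed.

Lemma diff_at_ext_loc (f g : C -> C) (p : C) (r : R) :
  0 < r -> (forall z, Cmod (z - p) < r -> f z = g z) -> diff_at f p -> diff_at g p.
Proof.
  intros Hr E [k [Hk H]]. apply diff_at_loc with (k := k) (r := r); [exact Hr | exact Hk |].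
  intros z Hz. rewrite <- !E; auto.
  replace (p - p)%C with (RtoC 0) by ring. now rewrite Cmod_0.
Qed.

Lemma diff_at_cont (f : C -> C) (p : C) : diff_at f p -> cont_at f p.
Proof.
  intros [k [Hk E]].
  apply cont_at_ext_loc with (f := fun z => (f p + k z * (z - p))%C) (r := 1); [lra | |].
  - intros z _. rewrite <- E. ring.
  - apply cont_at_plus; [apply cont_at_const|]. apply cont_at_mult; [exact Hk|].
    apply cont_at_minus; [apply cont_at_id | apply cont_at_const].
Qed.

Lemma diff_at_const (c p : C) : diff_at (fun _ => c) p.
Proof. exists (fun _ => RtoC 0). split; [apply cont_at_const | intros; ring]. Qed.

Lemma diff_at_id (p : C) : diff_at (fun z => z) p.
Proof. exists (fun _ => RtoC 1). split; [apply cont_at_const | intros; ring]. Qed.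

Lemma diff_at_plus (f g : C -> C) (p : C) :
  diff_at f p -> diff_at g p -> diff_at (fun z => f z + g z)%C p.
Proof.
  intros [k [Hk E]] [l [Hl F]]. exists (fun z => k z + l z)%C. split.
  - now apply cont_at_plus.
  - intros z. rewrite Cmult_plus_distr_r, <- E, <- F. ring.
Qed.

Lemma diff_at_mult (f g : C -> C) (p : C) :
  diff_at f p -> diff_at g p -> diff_at (fun z => f z * g z)%C p.
Proof.
  intros Df Dg. pose proof (diff_at_cont g p Dg) as Cg.
  destruct Df as [k [Hk E]]. destruct Dg as [l [Hl F]].
  exists (fun z => k z * g z + f p * l z)%C. split.
  - apply cont_at_plus; apply cont_at_mult; try assumption. apply cont_at_const.
  - intros z.
    transitivity ((f z - f p) * g z + f p * (g z - g p))%C; [ring|].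
    rewrite E, F. ring.
Qed.

Lemma diff_at_opp (f : C -> C) (p : C) : diff_at f p -> diff_at (fun z => - f z)%C p.
Proof.
  intros [k [Hk E]]. exists (fun z => - k z)%C. split.
  - now apply cont_at_opp.
  - intros z. transitivity (- (f z - f p))%C; [ring|]. rewrite E. ring.
Qed.

Lemma diff_at_minus (f g : C -> C) (p : C) :
  diff_at f p -> diff_at g p -> diff_at (fun z => f z - g z)%C p.
Proof. intros. apply diff_at_plus; [|apply diff_at_opp]; assumption. Qed.

Lemma diff_at_inv (f : C -> C) (p : C) :
  diff_at f p -> f p <> 0 -> diff_at (fun z => / f z)%C p.
Proof.
  intros Df H0. pose proof (diff_at_cont f p Df) as Cf.
  destruct (cont_at_neq f p Cf H0) as [r [Hr Hr']].
  destruct Df as [k [Hk E]].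
  apply diff_at_loc with (k := fun z => (- k z / (f z * f p))%C) (r := r); [exact Hr | |].
  - apply cont_at_div.
    + now apply cont_at_opp.
    + apply cont_at_mult; [exact Cf | apply cont_at_const].
    + now apply Cmult_neq_0.
  - intros z Hz. specialize (Hr' z Hz).
    assert (Hz0 : f z <> 0).
    { apply Cmod_gt_0. pose proof (Cmod_ge_0 (f p)). lra. }
    transitivity (- (f z - f p) / (f z * f p))%C; [field; auto|].
    rewrite E. field; auto.
Qed.

Lemma diff_at_div (f g : C -> C) (p : C) :
  diff_at f p -> diff_at g p -> g p <> 0 -> diff_at (fun z => f z / g z)%C p.
Proof. intros. apply diff_at_mult; [|apply diff_at_inv]; assumption. Qed.

Lemma diff_quot_comp (f g k l : C -> C) (p : C) :
  diff_quot f p k -> diff_quot g (f p) l ->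
  diff_quot (fun z => g (f z)) p (fun z => l (f z) * k z)%C.
Proof.
  intros Df [Hl F].
  assert (Cf : cont_at f p) by (apply diff_at_cont; now exists k).
  destruct Df as [Hk E]. split.
  - apply cont_at_mult; [|exact Hk]. now apply cont_at_comp.
  - intros z. rewrite F, E. ring.
Qed.

Lemma diff_at_comp (f g : C -> C) (p : C) :
  diff_at f p -> diff_at g (f p) -> diff_at (fun z => g (f z)) p.
Proof. intros [k Hk] [l Hl]. eexists. now apply diff_quot_comp with (1 := Hk) (2 := Hl). Qed.

Lemma locally_Cmod (p : C) (P : C -> Prop) :
  locally p P <-> exists r, 0 < r /\ forall z, Cmod (z - p) < r -> P z.
Proof.
  split.
  - intros H. apply (proj1 (locally_C p P)) in H. destruct H as [e He].
    exists e. split; [apply cond_pos|]. intros z Hz. apply He. exact Hz.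
  - intros [r [Hr H]]. apply (proj2 (locally_C p P)).
    exists (mkposreal r Hr). intros z Hz. apply H. exact Hz.
Qed.

(** The little-o remainder divided by z - p is the continuity at p of the quotient extended by the
    value d. *)
Lemma is_derive_diff_quot (f : C -> C) (p d : C) :
  @is_derive C_AbsRing C_NormedModule f p d -> exists k, diff_quot f p k /\ k p = d.
Proof.
  intros [_ H].
  assert (P : cont_at (fun z => if excluded_middle_informative (z = p) then d
                         else ((f z - f p) / (z - p))%C) p).
  { intros eps He.
    destruct (H p (fun P HP => HP) (mkposreal (eps / 2) ltac:(lra))) as [e He'].
    exists e. split; [apply cond_pos|]. intros z Hz.
    destruct (excluded_middle_informative (p = p)) as [_|n]; [|now contradict n].
    destruct (excluded_middle_informative (z = p)) as [h|h].
    - replace (d - d)%C with (RtoC 0) by ring. now rewrite Cmod_0.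
    - specialize (He' z Hz).
      assert (Q : Cmod (f z - f p - (z - p) * d) <= eps / 2 * Cmod (z - p)) by exact He'.
      pose proof (Cmod_minus_pos z p h) as Pz.
      replace ((f z - f p) / (z - p) - d)%C with ((f z - f p - (z - p) * d) / (z - p))%C.
      2: { field. now apply Cmod_gt_0. }
      rewrite Cmod_div by now apply Cmod_gt_0.
      apply Rle_lt_trans with (eps / 2); [|lra].
      apply Rmult_le_reg_r with (Cmod (z - p)); [exact Pz|].
      unfold Rdiv at 1. rewrite Rmult_assoc, Rinv_l by lra. lra. }
  eexists. split; [split; [exact P|]|].
  - intros z. cbv beta. destruct (excluded_middle_informative (z = p)) as [h|h].
    + rewrite h. ring.
    + field. apply Cmod_gt_0. now apply Cmod_minus_pos.
  - cbv beta. destruct (excluded_middle_informative (p = p)) as [_|n]; [reflexivity | now contradict n].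
Qed.

Lemma diff_quot_C_derive (f k : C -> C) (p : C) : diff_quot f p k -> C_derive f p = k p.
Proof.
  intros [Hk E]. apply is_C_derive_unique. split.
  - apply (is_linear_scal_l (K := C_AbsRing) (V := C_NormedModule)).
  - intros x Hx. apply (is_filter_lim_locally_unique (K := C_AbsRing) (V := AbsRing_NormedModule C_AbsRing)) in Hx. subst x.
    intros eps. destruct (Hk eps (cond_pos eps)) as [e [He H]].
    exists (mkposreal e He). intros z Hz. specialize (H z Hz).
    change (Cmod (f z - f p - (z - p) * k p) <= eps * Cmod (z - p)).
    rewrite E. replace (k z * (z - p) - (z - p) * k p)%C with ((k z - k p) * (z - p))%C by ring.
    rewrite Cmod_mult. apply Rmult_le_compat_r; [apply Cmod_ge_0 | lra].
Qed.

(** * Compactness and Goursat's theorem *)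

(** Bolzano-Weierstrass by a gauge: if there is no cluster point, every point has a radius delta
    such that u avoids the point beyond rank 1 / delta. Compactness of the square bounds the useful
    radii below by some d, and a term of rank beyond 1 / d has nowhere to lie. *)
Lemma C_bounded_cluster (u : nat -> C) (M : R) :
  (forall n, Cmod (u n) <= M) ->
  exists l : C, forall eps, 0 < eps -> forall N, exists n, (N <= n)%nat /\ Cmod (u n - l) < eps.
Proof.
  intros Hu. apply NNPP. intros Hno.
  (* delta also encodes the rank from which u stays away from (x, y). *)
  assert (Hd : forall x y : R, exists d : posreal,
             forall n, / d <= INR n -> 2 * d <= Cmod (u n - (x, y))%C).
  { intros x y. apply NNPP. intros H. apply Hno. exists (x, y). intros e He N.
    apply NNPP. intros Hn. apply H.
    assert (P : 0 < Rmin (e / 2) (/ (INR N + 1))).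
    { apply Rmin_pos; [lra|]. apply Rinv_0_lt_compat. pose proof (pos_INR N). lra. }
    exists (mkposreal _ P). simpl. intros n Hnn.
    destruct (Rlt_le_dec (Cmod (u n - (x, y))%C) e) as [h|h].
    - exfalso. apply Hn. exists n. split; [|exact h].
      apply INR_le.
      assert (Q : INR N + 1 <= / Rmin (e / 2) (/ (INR N + 1))).
      { rewrite <- (Rinv_inv (INR N + 1)) at 1. apply Rinv_le_contravar; [exact P | apply Rmin_r]. }
      lra.
    - pose proof (Rmin_l (e / 2) (/ (INR N + 1))). lra. }
  pose (delta := fun x y => proj1_sig (constructive_indefinite_description _ (Hd x y))).
  destruct (compactness_value_2d (- M) M (- M) M delta) as [d Hdd].
  destruct (nfloor_ex (/ d)) as [n [_ Hn]].
  { left. apply Rinv_0_lt_compat, cond_pos. }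
  pose proof (Rmax_Cmod (u (S n))) as R1.
  pose proof (Rmax_l (Rabs (fst (u (S n)))) (Rabs (snd (u (S n))))).
  pose proof (Rmax_r (Rabs (fst (u (S n)))) (Rabs (snd (u (S n))))).
  specialize (Hu (S n)).
  apply (Hdd (fst (u (S n))) (snd (u (S n)))).
  - apply Rabs_le_between. lra.
  - apply Rabs_le_between. lra.
  - intros [x [y [_ [_ [Hx [Hy Hl]]]]]].
    unfold delta in *. destruct (constructive_indefinite_description _ (Hd x y)) as [e He].
    simpl in *. specialize (He (S n)).
    assert (Q : / e <= INR (S n)).
    { rewrite S_INR. apply Rle_trans with (/ d); [|lra].
      apply Rinv_le_contravar; [apply cond_pos | exact Hl]. }
    specialize (He Q).
    pose proof (Cmod_2Rmax (u (S n) - (x, y))%C) as B. simpl in B.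
    (* The factor 2 in the gauge absorbs the passage from the sup norm of the square to [Cmod]. *)
    assert (S2 : sqrt 2 < 2).
    { rewrite <- (sqrt_square 2) at 2 by lra. apply sqrt_lt_1; lra. }
    assert (Rmax (Rabs (fst (u (S n)) + - x)) (Rabs (snd (u (S n)) + - y)) < e).
    { apply Rmax_lub_lt; assumption. }
    pose proof (sqrt_pos 2). pose proof (cond_pos e).
    pose proof (Rle_trans _ _ _ (Rabs_pos _) (Rmax_l (Rabs (fst (u (S n)) + - x)) (Rabs (snd (u (S n)) + - y)))).
    nra.
Qed.

Lemma nested_intervals (a b : nat -> R) :
  (forall n, a n <= a (S n)) -> (forall n, b (S n) <= b n) -> (forall n, a n <= b n) ->
  exists x, forall n, a n <= x <= b n.
Proof.
  intros Ha Hb Hab.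
  assert (Ha' : forall n m, (n <= m)%nat -> a n <= a m).
  { intros n m H. induction H; [lra|]. specialize (Ha m). lra. }
  assert (Hb' : forall n m, (n <= m)%nat -> b m <= b n).
  { intros n m H. induction H; [lra|]. specialize (Hb m). lra. }
  assert (Hub : forall n m, a n <= b m).
  { intros n m. specialize (Ha' n (max n m) (Nat.le_max_l _ _)).
    specialize (Hb' m (max n m) (Nat.le_max_r _ _)). specialize (Hab (max n m)). lra. }
  destruct (completeness (fun x => exists n, x = a n)) as [x [U L]].
  - exists (b 0%nat). intros y [n ->]. apply Hub.
  - exists (a 0%nat), 0%nat. reflexivity.
  - exists x. intros n. split; [apply U; now exists n|].
    apply L. intros y [m ->]. apply Hub.
Qed.

(* u and v are the real and imaginary part of a function that is complex
   differentiable at x + i y, with derivative al + i be. *)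
Definition CR_at (u v : R -> R -> R) (x y : R) : Prop :=
  exists al be : R,
    differentiable_pt_lim u x y al (- be) /\ differentiable_pt_lim v x y be al.

(* Imaginary part of the integral of u + i v along the boundary of [a,b] x [c,d]. *)
Definition bd_int (u v : R -> R -> R) (a b c d : R) : R :=
  RInt (fun x => v x c - v x d) a b + RInt (fun y => u b y - u a y) c d.

Definition CR_on (u v : R -> R -> R) (a b c d : R) : Prop :=
  forall x y, a <= x <= b -> c <= y <= d -> CR_at u v x y.

Lemma differentiable_continuous_fst (u : R -> R -> R) (x y lx ly : R) :
  differentiable_pt_lim u x y lx ly -> continuous (fun t => u t y) x.
Proof.
  intros H. apply continuity_pt_filterlim, derivable_continuous_pt.
  eexists. apply derivable_pt_lim_comp_2d with (f2 := fun t => t) (f3 := fun _ => y) (1 := H).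
  - apply derivable_pt_lim_id.
  - apply derivable_pt_lim_const.
Qed.

Lemma differentiable_continuous_snd (u : R -> R -> R) (x y lx ly : R) :
  differentiable_pt_lim u x y lx ly -> continuous (fun t => u x t) y.
Proof.
  intros H. apply continuity_pt_filterlim, derivable_continuous_pt.
  eexists. apply derivable_pt_lim_comp_2d with (f2 := fun t => x) (f3 := fun t => t) (1 := H).
  - apply derivable_pt_lim_const.
  - apply derivable_pt_lim_id.
Qed.

Lemma CR_on_ex_RInt_h (u v : R -> R -> R) (a b c d : R) :
  a <= b -> c <= d -> CR_on u v a b c d -> ex_RInt (fun x => v x c - v x d) a b.
Proof.
  intros Hab Hcd H. apply (ex_RInt_continuous (V := R_CompleteNormedModule)). intros x Hx.
  rewrite Rmin_left, Rmax_right in Hx by lra.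
  destruct (H x c Hx ltac:(lra)) as [al [be [_ D]]].
  destruct (H x d Hx ltac:(lra)) as [al' [be' [_ D']]].
  apply (continuous_minus (V := R_NormedModule)); eapply differentiable_continuous_fst; eassumption.
Qed.

Lemma CR_on_ex_RInt_v (u v : R -> R -> R) (a b c d : R) :
  a <= b -> c <= d -> CR_on u v a b c d -> ex_RInt (fun y => u b y - u a y) c d.
Proof.
  intros Hab Hcd H. apply (ex_RInt_continuous (V := R_CompleteNormedModule)). intros y Hy.
  rewrite Rmin_left, Rmax_right in Hy by lra.
  destruct (H a y ltac:(lra) Hy) as [al [be [D _]]].
  destruct (H b y ltac:(lra) Hy) as [al' [be' [D' _]]].
  apply (continuous_minus (V := R_NormedModule)); eapply differentiable_continuous_snd; eassumption.
Qed.

Lemma CR_on_sub (u v : R -> R -> R) (a b c d a' b' c' d' : R) :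
  a <= a' -> b' <= b -> c <= c' -> d' <= d -> CR_on u v a b c d -> CR_on u v a' b' c' d'.
Proof. intros ? ? ? ? H x y Hx Hy. apply H; lra. Qed.

(** The two halves traverse the common side at m in opposite directions, so its contributions
    cancel. *)
Lemma bd_int_split_h (u v : R -> R -> R) (a m b c d : R) :
  a <= m <= b -> c <= d -> CR_on u v a b c d ->
  bd_int u v a b c d = bd_int u v a m c d + bd_int u v m b c d.
Proof.
  intros Hm Hcd H. unfold bd_int.
  assert (H1 : CR_on u v a m c d) by (revert H; apply CR_on_sub; lra).
  assert (H2 : CR_on u v m b c d) by (revert H; apply CR_on_sub; lra).
  rewrite <- (RInt_Chasles (V := R_CompleteNormedModule) (fun x => v x c - v x d) a m b);
    [| apply CR_on_ex_RInt_h with (u := u); try assumption; lra ..].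
  assert (E : RInt (fun y => u b y - u a y) c d =
              RInt (fun y => u m y - u a y) c d + RInt (fun y => u b y - u m y) c d).
  { rewrite <- (RInt_plus (V := R_CompleteNormedModule));
      [| eapply CR_on_ex_RInt_v; try eassumption; lra ..].
    apply RInt_ext. intros y _. unfold plus; simpl. ring. }
  rewrite E. unfold plus; simpl. ring.
Qed.

Lemma bd_int_split_v (u v : R -> R -> R) (a b c m d : R) :
  a <= b -> c <= m <= d -> CR_on u v a b c d ->
  bd_int u v a b c d = bd_int u v a b c m + bd_int u v a b m d.
Proof.
  intros Hab Hm H. unfold bd_int.
  assert (H1 : CR_on u v a b c m) by (revert H; apply CR_on_sub; lra).
  assert (H2 : CR_on u v a b m d) by (revert H; apply CR_on_sub; lra).
  rewrite <- (RInt_Chasles (V := R_CompleteNormedModule) (fun y => u b y - u a y) c m d);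
    [| apply CR_on_ex_RInt_v with (v := v); try assumption; lra ..].
  assert (E : RInt (fun x => v x c - v x d) a b =
              RInt (fun x => v x c - v x m) a b + RInt (fun x => v x m - v x d) a b).
  { rewrite <- (RInt_plus (V := R_CompleteNormedModule));
      [| eapply CR_on_ex_RInt_h; try eassumption; lra ..].
    apply RInt_ext. intros x _. unfold plus; simpl. ring. }
  rewrite E. unfold plus; simpl. ring.
Qed.

Lemma RInt_near_const (f : R -> R) (a b c e : R) :
  a <= b -> ex_RInt f a b -> (forall t, a <= t <= b -> Rabs (f t - c) <= e) ->
  Rabs (RInt f a b - (b - a) * c) <= (b - a) * e.
Proof.
  intros Hab Hf H.
  assert (E : RInt f a b - (b - a) * c = RInt (fun t => f t - c) a b).
  { rewrite (RInt_minus (V := R_CompleteNormedModule) f (fun _ => c)).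
    - rewrite RInt_const. reflexivity.
    - exact Hf.
    - apply ex_RInt_const. }
  rewrite E. apply abs_RInt_le_const; [exact Hab | | exact H].
  apply (ex_RInt_minus (V := R_NormedModule)); [exact Hf | apply ex_RInt_const].
Qed.

(* The affine part of u + i v integrates to 0; only the remainder counts. *)
Lemma bd_int_small (u v : R -> R -> R) (X Y eps : R) :
  0 < eps -> CR_at u v X Y ->
  exists delta, 0 < delta /\ forall a b c d,
    a <= X <= b -> c <= Y <= d -> b - a < delta -> d - c < delta ->
    CR_on u v a b c d ->
    Rabs (bd_int u v a b c d) <= 2 * eps * ((b - a) + (d - c)) ^ 2.
Proof.
  intros He [al [be [Du Dv]]].
  destruct (Du (mkposreal eps He)) as [d1 H1].
  destruct (Dv (mkposreal eps He)) as [d2 H2]. simpl in H1, H2.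
  exists (Rmin d1 d2). split; [apply Rmin_pos; apply cond_pos|].
  intros a b c d HX HY Hw Hh H.
  pose proof (Rmin_l d1 d2). pose proof (Rmin_r d1 d2).
  set (L := (b - a) + (d - c)).
  assert (Bx : forall x, a <= x <= b -> Rabs (x - X) <= b - a).
  { intros x Hx. apply Rabs_le_between. lra. }
  assert (By : forall y, c <= y <= d -> Rabs (y - Y) <= d - c).
  { intros y Hy. apply Rabs_le_between. lra. }
  assert (Bu : forall x y, a <= x <= b -> c <= y <= d ->
     Rabs (u x y - u X Y - (al * (x - X) + - be * (y - Y))) <= eps * L).
  { intros x y Hx Hy. specialize (Bx x Hx). specialize (By y Hy).
    eapply Rle_trans; [apply H1; lra|].
    apply Rmult_le_compat_l; [lra|]. unfold L. apply Rmax_lub; lra. }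
  assert (Bv : forall x y, a <= x <= b -> c <= y <= d ->
     Rabs (v x y - v X Y - (be * (x - X) + al * (y - Y))) <= eps * L).
  { intros x y Hx Hy. specialize (Bx x Hx). specialize (By y Hy).
    eapply Rle_trans; [apply H2; lra|].
    apply Rmult_le_compat_l; [lra|]. unfold L. apply Rmax_lub; lra. }
  (* The constants are the affine parts of the two integrands; integrated, they give (b - a) * al *
     (c - d) and (d - c) * al * (b - a), which cancel. Each integrand is a difference of two values,
     whence the error 2 * eps * L. *)
  assert (I1 := RInt_near_const (fun x => v x c - v x d) a b (al * (c - d)) (2 * (eps * L))
     ltac:(lra) (CR_on_ex_RInt_h u v a b c d ltac:(lra) ltac:(lra) H)).
  assert (I2 := RInt_near_const (fun y => u b y - u a y) c d (al * (b - a)) (2 * (eps * L))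
     ltac:(lra) (CR_on_ex_RInt_v u v a b c d ltac:(lra) ltac:(lra) H)).
  assert (J1 : forall t, a <= t <= b -> Rabs (v t c - v t d - al * (c - d)) <= 2 * (eps * L)).
  { intros t Ht. pose proof (Bv t c Ht ltac:(lra)) as P1. pose proof (Bv t d Ht ltac:(lra)) as P2.
    apply Rabs_le_between in P1, P2. apply Rabs_le_between. lra. }
  assert (J2 : forall t, c <= t <= d -> Rabs (u b t - u a t - al * (b - a)) <= 2 * (eps * L)).
  { intros t Ht. pose proof (Bu b t ltac:(lra) Ht) as P1. pose proof (Bu a t ltac:(lra) Ht) as P2.
    apply Rabs_le_between in P1, P2. apply Rabs_le_between. lra. }
  specialize (I1 J1). specialize (I2 J2). unfold bd_int.
  apply Rabs_le_between in I1, I2. apply Rabs_le_between.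
  unfold L in *. lra.
Qed.

(** Pigeonhole over the four quarters, whose integrals add up to that of the whole. *)
Lemma bd_int_quarter (u v : R -> R -> R) (a b c d : R) :
  a <= b -> c <= d -> CR_on u v a b c d ->
  exists a' c', (a' = a \/ a' = a + (b - a) / 2) /\ (c' = c \/ c' = c + (d - c) / 2) /\
    Rabs (bd_int u v a b c d) / 4 <=
    Rabs (bd_int u v a' (a' + (b - a) / 2) c' (c' + (d - c) / 2)).
Proof.
  intros Hab Hcd H. set (m := a + (b - a) / 2). set (n := c + (d - c) / 2).
  assert (Hm : a <= m <= b) by (unfold m; lra).
  assert (Hn : c <= n <= d) by (unfold n; lra).
  assert (E := bd_int_split_h u v a m b c d Hm Hcd H).
  rewrite (bd_int_split_v u v a m c n d) in E
    by (try (revert H; apply CR_on_sub); lra).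
  rewrite (bd_int_split_v u v m b c n d) in E
    by (try (revert H; apply CR_on_sub); lra).
  apply NNPP. intros Hno.
  assert (K : forall a' c', (a' = a \/ a' = m) -> (c' = c \/ c' = n) ->
     Rabs (bd_int u v a' (a' + (b - a) / 2) c' (c' + (d - c) / 2)) < Rabs (bd_int u v a b c d) / 4).
  { intros a' c' Ha Hc. apply Rnot_le_lt. intros Hle. apply Hno. exists a', c'. auto. }
  pose proof (K a c ltac:(now left) ltac:(now left)) as K1.
  pose proof (K a n ltac:(now left) ltac:(now right)) as K2.
  pose proof (K m c ltac:(now right) ltac:(now left)) as K3.
  pose proof (K m n ltac:(now right) ltac:(now right)) as K4.
  replace (m + (b - a) / 2) with b in * by (unfold m; lra).
  replace (n + (d - c) / 2) with d in * by (unfold n; lra).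
  fold m n in K1, K2, K3, K4.
  pose proof (Rabs_triang (bd_int u v a m c n + bd_int u v a m n d)
                          (bd_int u v m b c n + bd_int u v m b n d)).
  pose proof (Rabs_triang (bd_int u v a m c n) (bd_int u v a m n d)).
  pose proof (Rabs_triang (bd_int u v m b c n) (bd_int u v m b n d)).
  rewrite <- E in *. lra.
Qed.

Lemma pow2_inv_lt (w e : R) : 0 < e -> exists N, forall n, (N <= n)%nat -> w / 2 ^ n < e.
Proof.
  intros He. destruct (pow_lt_1_zero (/ 2)) with (y := e / (Rabs w + 1)) as [N HN].
  - rewrite Rabs_right; lra.
  - apply Rdiv_lt_0_compat; [exact He|]. pose proof (Rabs_pos w). lra.
  - exists N. intros n Hn. specialize (HN n Hn).
    rewrite pow_inv, Rabs_right in HN.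
    2: { left. apply Rinv_0_lt_compat, pow_lt. lra. }
    pose proof (Rabs_pos w). pose proof (Rle_abs w).
    assert (P : 0 < / 2 ^ n) by (apply Rinv_0_lt_compat, pow_lt; lra).
    apply Rmult_lt_compat_r with (r := Rabs w + 1) in HN; [|lra].
    unfold Rdiv in HN. rewrite Rmult_assoc, Rinv_l, Rmult_1_r in HN by lra.
    unfold Rdiv. nra.
Qed.

(** Repeated quartering of a rectangle with integral of modulus K > 0 leaves cells with integral at
    least K / 4^n. At the point to which they shrink, differentiability bounds it by 2 * eps * L^2 /
    4^n. Both bounds scale alike, so a small eps is contradictory. *)
Lemma goursat (u v : R -> R -> R) (a b c d : R) :
  a <= b -> c <= d -> CR_on u v a b c d -> bd_int u v a b c d = 0.
Proof.
  intros Hab Hcd H. apply NNPP. intros Hne.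
  set (K := Rabs (bd_int u v a b c d)).
  assert (HK : 0 < K) by now apply Rabs_pos_lt.
  set (w := fun n => (b - a) / 2 ^ n). set (h := fun n => (d - c) / 2 ^ n).
  assert (Wn : forall n, w (S n) = w n / 2).
  { intros n. unfold w. simpl. field. apply pow_nonzero. lra. }
  assert (Hn : forall n, h (S n) = h n / 2).
  { intros n. unfold h. simpl. field. apply pow_nonzero. lra. }
  assert (Wp : forall n, 0 <= w n /\ 0 <= h n).
  { intros n. unfold w, h. assert (0 < / 2 ^ n) by (apply Rinv_0_lt_compat, pow_lt; lra).
    split; apply Rmult_le_pos; lra. }
  set (Bad := fun n (p : R * R) =>
    a <= fst p /\ fst p + w n <= b /\ c <= snd p /\ snd p + h n <= d /\
    K / 4 ^ n <= Rabs (bd_int u v (fst p) (fst p + w n) (snd p) (snd p + h n))).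
  assert (Step : forall n p, Bad n p -> { p' | Bad (S n) p' /\
     fst p <= fst p' /\ fst p' + w (S n) <= fst p + w n /\
     snd p <= snd p' /\ snd p' + h (S n) <= snd p + h n }).
  { intros n [x y] [B1 [B2 [B3 [B4 B5]]]]. simpl in *.
    apply constructive_indefinite_description.
    destruct (Wp n) as [W1 W2].
    destruct (bd_int_quarter u v x (x + w n) y (y + h n)) as [x' [y' [Hx [Hy HQ]]]];
      [lra | lra | revert H; apply CR_on_sub; lra |].
    replace (x + w n - x) with (w n) in * by ring.
    replace (y + h n - y) with (h n) in * by ring.
    exists (x', y'). unfold Bad. rewrite !Wn, !Hn. simpl.
    assert (E4 : K / (4 * 4 ^ n) = K / 4 ^ n / 4) by (field; apply pow_nonzero; lra).
    rewrite E4. repeat split; try (destruct Hx, Hy; lra). }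
  assert (B0 : Bad 0%nat (a, c)).
  { unfold Bad, w, h. simpl. rewrite !Rdiv_1_r.
    replace (a + (b - a)) with b by ring. replace (c + (d - c)) with d by ring.
    repeat split; try lra. fold K. lra. }
  (* Lower left corners of the chosen cells, carried with their proofs of badness because [Step]
     consumes them. *)
  pose (cell := nat_rect (fun n => {p | Bad n p}) (exist _ _ B0)
     (fun n P => exist _ (proj1_sig (Step n (proj1_sig P) (proj2_sig P)))
                   (proj1 (proj2_sig (Step n (proj1_sig P) (proj2_sig P)))))).
  assert (Cs : forall n, let p := proj1_sig (cell n) in let p' := proj1_sig (cell (S n)) in
     fst p <= fst p' /\ fst p' + w (S n) <= fst p + w n /\
     snd p <= snd p' /\ snd p' + h (S n) <= snd p + h n).
  { intros n. simpl. exact (proj2 (proj2_sig (Step n (proj1_sig (cell n)) (proj2_sig (cell n))))). }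
  destruct (nested_intervals (fun n => fst (proj1_sig (cell n)))
              (fun n => fst (proj1_sig (cell n)) + w n)) as [X HX];
    [intros n; apply Cs | intros n; apply Cs | intros n; destruct (Wp n); lra |].
  destruct (nested_intervals (fun n => snd (proj1_sig (cell n)))
              (fun n => snd (proj1_sig (cell n)) + h n)) as [Y HY];
    [intros n; apply Cs | intros n; apply Cs | intros n; destruct (Wp n); lra |].
  simpl in HX, HY.
  set (L := (b - a) + (d - c)).
  (* Chosen so that 2 * eps * L^2 < K; the + 1 covers a degenerate rectangle, where L = 0. *)
  set (eps := K / (4 * (L ^ 2 + 1))).
  assert (L2 : 0 <= L ^ 2) by apply pow2_ge_0.
  assert (Heps : 0 < eps) by (apply Rdiv_lt_0_compat; lra).
  assert (HXY : CR_at u v X Y).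
  { destruct (proj2_sig (cell 0%nat)) as [B1 [B2 [B3 [B4 _]]]].
    specialize (HX 0%nat). specialize (HY 0%nat). apply H; lra. }
  destruct (bd_int_small u v X Y eps Heps HXY) as [delta [Hdelta Hs]].
  destruct (pow2_inv_lt (b - a) delta Hdelta) as [N1 HN1].
  destruct (pow2_inv_lt (d - c) delta Hdelta) as [N2 HN2].
  set (n := (N1 + N2)%nat).
  specialize (HN1 n ltac:(unfold n; lia)). specialize (HN2 n ltac:(unfold n; lia)).
  fold (w n) in HN1. fold (h n) in HN2.
  destruct (proj2_sig (cell n)) as [B1 [B2 [B3 [B4 B5]]]].
  specialize (HX n). specialize (HY n).
  set (x := fst (proj1_sig (cell n))) in *. set (y := snd (proj1_sig (cell n))) in *.
  specialize (Hs x (x + w n) y (y + h n) HX HY ltac:(lra) ltac:(lra)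
                 ltac:(revert H; apply CR_on_sub; lra)).
  replace (x + w n - x) with (w n) in Hs by ring.
  replace (y + h n - y) with (h n) in Hs by ring.
  assert (E : w n + h n = L / 2 ^ n) by (unfold w, h, L; field; apply pow_nonzero; lra).
  rewrite E in Hs.
  assert (E4 : (L / 2 ^ n) ^ 2 = L ^ 2 / 4 ^ n).
  { replace 4 with (2 * 2) by ring. rewrite Rpow_mult_distr. field. apply pow_nonzero; lra. }
  rewrite E4 in Hs.
  assert (P4 : 0 < / 4 ^ n) by (apply Rinv_0_lt_compat, pow_lt; lra).
  assert (F : K * / 4 ^ n <= 2 * eps * L ^ 2 * / 4 ^ n) by (unfold Rdiv in *; lra).
  apply Rmult_le_reg_r in F; [|exact P4].
  assert (G : eps * (4 * (L ^ 2 + 1)) = K) by (unfold eps; field; lra).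
  nra.
Qed.

(** * Circle means and the maximum principle *)

Lemma cont_at_conj (f : C -> C) (p : C) : cont_at f p -> cont_at (fun z => Cconj (f z)) p.
Proof.
  intros Hf eps He. destruct (Hf eps He) as [e [H1 H2]]. exists e. split; [exact H1|].
  intros z Hz. rewrite <- Cminus_conj, Cmod_conj. now apply H2.
Qed.

Lemma Re_minus_le (a b : C) : Rabs (Re a - Re b) <= Cmod (a - b).
Proof. exact (re_le_Cmod (a - b)). Qed.

(** By [Cl], the values of Re W along any sequence in the closed disc cluster at a value of Re W
    there. Points with Re W > n would contradict this, which gives boundedness; a maximizing
    sequence then gives the maximum. *)
Lemma disc_max (W : C -> C) (r : R) :
  0 <= r -> (forall p, Cmod p <= r -> cont_at W p) ->
  exists p, Cmod p <= r /\ forall z, Cmod z <= r -> Re (W z) <= Re (W p).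
Proof.
  intros Hr HW.
  assert (Cl : forall z : nat -> C, (forall n, Cmod (z n) <= r) ->
     exists p, Cmod p <= r /\ forall eps, 0 < eps -> forall N, exists n,
       (N <= n)%nat /\ Rabs (Re (W (z n)) - Re (W p)) < eps).
  { intros z Hz. destruct (C_bounded_cluster z r Hz) as [p Hp]. exists p.
    assert (Pr : Cmod p <= r).
    { apply Rnot_lt_le. intros h. destruct (Hp (Cmod p - r) ltac:(lra) 0%nat) as [n [_ Hn]].
      pose proof (Cmod_triangle_rev p (z n)). rewrite Cmod_minus_sym in Hn.
      specialize (Hz n). lra. }
    split; [exact Pr|]. intros eps He N.
    destruct (HW p Pr eps He) as [e [He' H]].
    destruct (Hp e He' N) as [n [Hn Hn']]. exists n. split; [exact Hn|].
    eapply Rle_lt_trans; [apply Re_minus_le | now apply H]. }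
  assert (Bd : exists M, forall z, Cmod z <= r -> Re (W z) <= M).
  { apply NNPP. intros Hno.
    assert (Hz : forall n, exists z, Cmod z <= r /\ INR n < Re (W z)).
    { intros n. apply NNPP. intros h. apply Hno. exists (INR n). intros z Hz.
      apply Rnot_lt_le. intros h'. apply h. now exists z. }
    pose (z := fun n => proj1_sig (constructive_indefinite_description _ (Hz n))).
    assert (Pz : forall n, Cmod (z n) <= r /\ INR n < Re (W (z n))).
    { intros n. exact (proj2_sig (constructive_indefinite_description _ (Hz n))). }
    destruct (Cl z (fun n => proj1 (Pz n))) as [p [_ Hp]].
    destruct (INR_unbounded (Re (W p) + 1)) as [N HN].
    destruct (Hp 1 ltac:(lra) N) as [n [Hn Hn']].
    apply le_INR in Hn. destruct (Pz n) as [_ Pn].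
    apply Rabs_lt_between in Hn'. lra. }
  destruct Bd as [M HM].
  destruct (completeness (fun y => exists z, Cmod z <= r /\ y = Re (W z))) as [m [U L]].
  { exists M. intros y [z [Hz ->]]. now apply HM. }
  { exists (Re (W 0)), 0. rewrite Cmod_0. auto. }
  assert (Hz : forall n, exists z, Cmod z <= r /\ m - / (INR n + 1) < Re (W z)).
  { intros n. apply NNPP. intros h.
    assert (P : 0 < / (INR n + 1)) by (apply Rinv_0_lt_compat; pose proof (pos_INR n); lra).
    assert (m <= m - / (INR n + 1)); [|lra].
    apply L. intros y [z [Hz ->]]. apply Rnot_lt_le. intros h'. apply h. now exists z. }
  pose (z := fun n => proj1_sig (constructive_indefinite_description _ (Hz n))).
  assert (Pz : forall n, Cmod (z n) <= r /\ m - / (INR n + 1) < Re (W (z n))).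
  { intros n. exact (proj2_sig (constructive_indefinite_description _ (Hz n))). }
  destruct (Cl z (fun n => proj1 (Pz n))) as [p [Hpr Hp]].
  exists p. split; [exact Hpr|]. intros w Hw.
  apply Rle_trans with m; [apply U; now exists w|].
  apply Rnot_lt_le. intros h. set (e := (m - Re (W p)) / 2).
  assert (He : 0 < e) by (unfold e; lra).
  destruct (INR_unbounded (/ e)) as [N HN].
  destruct (Hp e He N) as [n [Hn Hn']]. destruct (Pz n) as [_ Pn].
  apply le_INR in Hn.
  assert (/ (INR n + 1) <= e).
  { rewrite <- (Rinv_inv e). apply Rinv_le_contravar; [now apply Rinv_0_lt_compat | lra]. }
  apply Rabs_lt_between in Hn'. unfold e in *. lra.
Qed.

Lemma diff_at_CR (f : C -> C) (x y : R) :
  diff_at f (x, y) -> CR_at (fun x y => Re (f (x, y))) (fun x y => Im (f (x, y))) x y.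
Proof.
  intros [k [Hk E]]. exists (Re (k (x, y))), (Im (k (x, y))).
  assert (H : forall eps : posreal, locally_2d (fun u v =>
     Cmod (f (u, v) - f (x, y) - k (x, y) * ((u, v) - (x, y)))%C
       <= eps * Rmax (Rabs (u - x)) (Rabs (v - y))) x y).
  { intros eps. destruct (Hk (eps / 2)) as [e [He H]].
    { pose proof (cond_pos eps). lra. }
    assert (He2 : 0 < e / 2) by lra.
    exists (mkposreal _ He2). simpl. intros a b Ha Hb.
    set (m := Rmax (Rabs (a - x)) (Rabs (b - y))).
    assert (Hm : 0 <= m) by (eapply Rle_trans; [apply Rabs_pos | apply Rmax_l]).
    assert (S2 : sqrt 2 < 2).
    { rewrite <- (sqrt_square 2) at 2 by lra. apply sqrt_lt_1; lra. }
    pose proof (Cmod_2Rmax ((a, b) - (x, y))%C) as B. simpl in B. fold m in B.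
    assert (B2 : Cmod ((a, b) - (x, y)) <= 2 * m).
    { eapply Rle_trans; [exact B|]. apply Rmult_le_compat_r; lra. }
    assert (m < e / 2) by now apply Rmax_lub_lt.
    specialize (H (a, b) ltac:(lra)).
    rewrite E.
    replace (k (a, b) * ((a, b) - (x, y)) - k (x, y) * ((a, b) - (x, y)))%C
      with ((k (a, b) - k (x, y)) * ((a, b) - (x, y)))%C by ring.
    rewrite Cmod_mult. pose proof (Cmod_ge_0 (k (a, b) - k (x, y))).
    pose proof (Cmod_ge_0 ((a, b) - (x, y))). pose proof (cond_pos eps).
    apply Rle_trans with (eps / 2 * (2 * m)); [|right; field].
    apply Rmult_le_compat; lra. }
  split; intros eps; destruct (H eps) as [d Hd]; exists d; intros a b Ha Hb; specialize (Hd a b Ha Hb).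
  - eapply Rle_trans; [|exact Hd].
    eapply Rle_trans; [|apply re_le_Cmod]. right. f_equal.
    destruct (f (a, b)), (f (x, y)), (k (x, y)). unfold Re, Im. simpl. ring.
  - eapply Rle_trans; [|exact Hd].
    eapply Rle_trans; [|eapply Rle_trans; [apply Rmax_r | apply Rmax_Cmod]]. right. f_equal.
    destruct (f (a, b)), (f (x, y)), (k (x, y)). unfold Re, Im. simpl. ring.
Qed.

Lemma differentiable_pt_lim_mult (x y : R) : differentiable_pt_lim Rmult x y y x.
Proof.
  intros eps. exists eps. intros u v Hu Hv.
  replace (u * v - x * y - (y * (u - x) + x * (v - y))) with ((u - x) * (v - y)) by ring.
  rewrite Rabs_mult. apply Rmult_le_compat; try apply Rabs_pos; [lra | apply Rmax_r].
Qed.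

Lemma differentiable_pt_lim_proj2 (g : R -> R) (x y l : R) :
  derivable_pt_lim g y l -> differentiable_pt_lim (fun _ t => g t) x y 0 l.
Proof.
  intros H eps.
  destruct (differentiable_pt_lim_proj1_0 g y x l H eps) as [d Hd].
  exists d. intros u v Hu Hv. specialize (Hd v u Hv Hu).
  rewrite Rmax_comm.
  replace (0 * (u - x) + l * (v - y)) with (l * (v - y) + 0 * (u - x)) by ring. exact Hd.
Qed.

Lemma differentiable_pt_lim_exp_mult (g : R -> R) (s t l : R) :
  derivable_pt_lim g t l ->
  differentiable_pt_lim (fun s t => exp s * g t) s t (exp s * g t) (exp s * l).
Proof.
  intros H.
  pose proof (differentiable_pt_lim_comp Rmult (fun s _ => exp s) (fun _ t => g t) s t
    _ _ _ _ _ _ (differentiable_pt_lim_mult (exp s) (g t))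
    (differentiable_pt_lim_proj1_0 exp s t _ (derivable_pt_lim_exp s))
    (differentiable_pt_lim_proj2 g s t l H)) as D.
  replace (exp s * g t) with (g t * exp s + exp s * 0) at 1 by ring.
  replace (exp s * l) with (g t * 0 + exp s * l) at 1 by ring. exact D.
Qed.

Lemma diff_at_polar_CR (f : C -> C) (s t : R) :
  diff_at f (exp s * cos t, exp s * sin t) ->
  CR_at (fun s t => Re (f (exp s * cos t, exp s * sin t)))
        (fun s t => Im (f (exp s * cos t, exp s * sin t))) s t.
Proof.
  intros H. apply diff_at_CR in H. destruct H as [al [be [Du Dv]]].
  pose proof (differentiable_pt_lim_exp_mult cos s t _ (derivable_pt_lim_cos t)) as D1.
  pose proof (differentiable_pt_lim_exp_mult sin s t _ (derivable_pt_lim_sin t)) as D2.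
  pose proof (differentiable_pt_lim_comp _ _ _ s t _ _ _ _ _ _ Du D1 D2) as U.
  pose proof (differentiable_pt_lim_comp _ _ _ s t _ _ _ _ _ _ Dv D1 D2) as V.
  (* Real and imaginary part of z * f'(z) at z = e^(s+it), the derivative of f(e^(s+it)). *)
  exists (al * (exp s * cos t) + - be * (exp s * sin t)),
         (be * (exp s * cos t) + al * (exp s * sin t)).
  split.
  - replace (- (be * (exp s * cos t) + al * (exp s * sin t)))
      with (al * (exp s * - sin t) + - be * (exp s * cos t)) by ring. exact U.
  - replace (al * (exp s * cos t) + - be * (exp s * sin t))
      with (be * (exp s * - sin t) + al * (exp s * cos t)) by ring. exact V.
Qed.

Definition circ (rho t : R) : C := (rho * cos t, rho * sin t).

Lemma Cmod2 (z : C) : Cmod z ^ 2 = fst z ^ 2 + snd z ^ 2.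
Proof. exact (Cmod2_alt z). Qed.

Lemma Cmod_circ (rho t : R) : 0 <= rho -> Cmod (circ rho t) = rho.
Proof.
  intros H. apply Rsqr_inj; [apply Cmod_ge_0 | exact H |].
  rewrite !Rsqr_pow2, Cmod2. simpl.
  pose proof (sin2_cos2 t) as E. unfold Rsqr in E.
  transitivity (rho * rho * (sin t * sin t + cos t * cos t)); [ring|]. rewrite E. ring.
Qed.

(* Goursat's theorem for s + it |-> f (p + e^(s+it)): by periodicity the
   horizontal sides cancel, so circle means do not depend on the radius, and
   they tend to f p as s -> -oo. *)
Lemma circle_mean_not_below (f : C -> C) (p : C) (r rho kappa : R) :
  cont_at f p -> (forall z, 0 < Cmod (z - p) < r -> diff_at f z) ->
  0 < rho < r -> 0 < kappa ->
  ~ (forall t, Re (f (p + circ rho t)%C) <= Re (f p) - kappa).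
Proof.
  intros Hc Hd Hrho Hk Hle.
  set (g := fun z => f (p + z)%C).
  assert (Dg : forall z, 0 < Cmod z < r -> diff_at g z).
  { intros z Hz. apply diff_at_comp with (f := fun z => (p + z)%C).
    - apply diff_at_plus; [apply diff_at_const | apply diff_at_id].
    - apply Hd. replace (p + z - p)%C with z by ring. exact Hz. }
  destruct (Hc (kappa / 2) ltac:(lra)) as [e [He Hc']].
  (* On this inner circle Re f stays within kappa / 2 of Re (f p), while on the outer one it is at
     most Re (f p) - kappa; yet the two means agree. *)
  set (rho' := Rmin (e / 2) rho).
  assert (Hrho' : 0 < rho') by (apply Rmin_pos; lra).
  set (s1 := ln rho'). set (s2 := ln rho).
  assert (E1 : exp s1 = rho') by now apply exp_ln.
  assert (E2 : exp s2 = rho) by (apply exp_ln; lra).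
  assert (H12 : s1 <= s2).
  { destruct (Rmin_r (e / 2) rho) as [h|h]; fold rho' in h.
    - left. now apply ln_increasing.
    - right. unfold s1, s2. now rewrite h. }
  set (u := fun s t => Re (g (exp s * cos t, exp s * sin t))).
  set (v := fun s t => Im (g (exp s * cos t, exp s * sin t))).
  pose proof PI_RGT_0 as HPI.
  assert (HCR : CR_on u v s1 s2 0 (2 * PI)).
  { intros s t Hs _. apply diff_at_polar_CR. apply Dg.
    change (0 < Cmod (circ (exp s) t) < r).
    rewrite Cmod_circ by (left; apply exp_pos). split; [apply exp_pos|].
    apply Rle_lt_trans with (exp s2); [|lra].
    destruct Hs as [_ [h|h]]; [left; now apply exp_increasing | right; now rewrite h]. }
  pose proof (goursat u v s1 s2 0 (2 * PI) H12 ltac:(lra) HCR) as G.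
  assert (Xu : forall s, s1 <= s <= s2 -> ex_RInt (u s) 0 (2 * PI)).
  { intros s Hs. apply (ex_RInt_continuous (V := R_CompleteNormedModule)). intros t Ht.
    rewrite Rmin_left, Rmax_right in Ht by lra.
    destruct (HCR s t Hs Ht) as [al [be [D _]]].
    eapply differentiable_continuous_snd; exact D. }
  unfold bd_int in G.
  rewrite (RInt_ext (fun x => v x 0 - v x (2 * PI)) (fun _ => 0)) in G.
  2: { intros x _. unfold v. rewrite cos_0, cos_2PI, sin_0, sin_2PI. apply Rminus_diag_eq. reflexivity. }
  rewrite RInt_const in G.
  rewrite (RInt_minus (V := R_CompleteNormedModule) (u s2) (u s1)) in G
    by (apply Xu; lra).
  change ((s2 - s1) * 0 + (RInt (u s2) 0 (2 * PI) - RInt (u s1) 0 (2 * PI)) = 0) in G.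
  assert (I2 : RInt (u s2) 0 (2 * PI) <= (2 * PI) * (Re (f p) - kappa)).
  { replace ((2 * PI) * (Re (f p) - kappa)) with (RInt (fun _ => Re (f p) - kappa) 0 (2 * PI)).
    2: { rewrite RInt_const.
         change ((2 * PI - 0) * (Re (f p) - kappa) = 2 * PI * (Re (f p) - kappa)). ring. }
    apply RInt_le; [lra | apply Xu; lra | apply ex_RInt_const |].
    intros t _. unfold u, g. rewrite E2. apply Hle. }
  assert (I1 := RInt_near_const (u s1) 0 (2 * PI) (Re (f p)) (kappa / 2)
                  ltac:(lra) (Xu s1 ltac:(lra))).
  assert (J1 : forall t, 0 <= t <= 2 * PI -> Rabs (u s1 t - Re (f p)) <= kappa / 2).
  { intros t _. unfold u, g. rewrite E1. change (rho' * cos t, rho' * sin t) with (circ rho' t).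
    eapply Rle_trans; [apply Re_minus_le|]. left. apply Hc'.
    replace (p + circ rho' t - p)%C with (circ rho' t) by ring.
    rewrite Cmod_circ by lra. pose proof (Rmin_l (e / 2) rho). unfold rho'. lra. }
  specialize (I1 J1). apply Rabs_le_between in I1. nra.
Qed.

Definition near_holo (f : C -> C) : Prop :=
  forall p, Cmod p < 1 -> cont_at f p /\
    exists r, 0 < r /\ forall z, 0 < Cmod (z - p) < r -> diff_at f z.

(* |f|^2 + eta |z|^2 has no local maximum, since its circle means increase
   strictly. *)
Lemma max_principle (f : C -> C) :
  near_holo f ->
  (forall eps, 0 < eps -> exists r, r < 1 /\
     forall z, r <= Cmod z < 1 -> Cmod (f z) ^ 2 <= 1 + eps) ->
  forall z, Cmod z < 1 -> Cmod (f z) <= 1.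
Proof.
  intros Hf Hb p0 Hp0. apply Rnot_lt_le. intros Hgt.
  (* On the circle of radius r the perturbed function is at most 1 + 2 * eta, and at p0 it is at
     least |f p0|^2 = 1 + 3 * eta, so the maximum is not on the circle. *)
  set (eta := (Cmod (f p0) ^ 2 - 1) / 3).
  assert (Heta : 0 < eta) by (unfold eta; nra).
  destruct (Hb eta Heta) as [r0 [Hr0 Hb']].
  set (r := Rmax r0 (Rmax ((Cmod p0 + 1) / 2) 0)).
  pose proof (Rmax_l r0 (Rmax ((Cmod p0 + 1) / 2) 0)) as M1.
  pose proof (Rmax_r r0 (Rmax ((Cmod p0 + 1) / 2) 0)) as M2.
  pose proof (Rmax_l ((Cmod p0 + 1) / 2) 0). pose proof (Rmax_r ((Cmod p0 + 1) / 2) 0).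
  fold r in M1, M2.
  assert (Hr1 : r < 1) by (repeat apply Rmax_lub_lt; lra).
  set (W := fun z => (f z * Cconj (f z) + RtoC eta * (z * Cconj z))%C).
  assert (ReW : forall z, Re (W z) = Cmod (f z) ^ 2 + eta * Cmod z ^ 2).
  { intros z. unfold W. rewrite !Cmod2. simpl. ring. }
  destruct (disc_max W r) as [p [Hp Hmax]]; [lra | |].
  { intros p Hp. destruct (Hf p ltac:(lra)) as [Hc _].
    apply cont_at_plus.
    - apply cont_at_mult; [exact Hc | now apply cont_at_conj].
    - apply cont_at_mult; [apply cont_at_const|].
      apply cont_at_mult; [|apply cont_at_conj]; apply cont_at_id. }
  pose proof (Cmod_ge_0 p) as P0. pose proof (Cmod_ge_0 p0).
  destruct Hp as [Hp|Hp].
  - destruct (Hf p ltac:(lra)) as [Hc [r1 [Hr1' Hd]]].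
    set (rho := Rmin (r1 / 2) (r - Cmod p)).
    assert (Hrho : 0 < rho) by (apply Rmin_pos; lra).
    pose proof (Rmin_l (r1 / 2) (r - Cmod p)) as R1. pose proof (Rmin_r (r1 / 2) (r - Cmod p)) as R2.
    fold rho in R1, R2.
    (* Linearization of |f|^2 + eta |z|^2 at p, using |w|^2 = 2 Re(conj(w0) w) - |w0|^2 + |w -
       w0|^2. Dropping the square for f and keeping it for z, maximality at p makes Re G on the
       circle at most Re (G p) - eta * rho^2, and G is differentiable where f is. *)
    set (G := fun z => (RtoC 2 * Cconj (f p) * f z + RtoC (2 * eta) * Cconj p * z)%C).
    apply (circle_mean_not_below G p r1 rho (eta * rho ^ 2)).
    + apply cont_at_plus; apply cont_at_mult; try apply cont_at_const; [exact Hc | apply cont_at_id].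
    + intros z Hz. apply diff_at_plus; apply diff_at_mult; try apply diff_at_const;
        [now apply Hd | apply diff_at_id].
    + lra.
    + apply Rmult_lt_0_compat; [exact Heta | now apply pow_lt].
    + intros t. set (c := circ rho t).
      assert (Cc : Cmod c = rho) by (apply Cmod_circ; lra).
      assert (Hz : Cmod (p + c)%C <= r).
      { pose proof (Cmod_triangle p c). lra. }
      specialize (Hmax (p + c)%C Hz). rewrite !ReW in Hmax.
      rewrite <- Cc. rewrite !Cmod2 in *.
      unfold G. clear -Hmax. destruct (f p) as [a b]; destruct (f (p + c)%C) as [a' b'].
      destruct p as [x y]. destruct c as [x' y']. simpl in *.
      pose proof (pow2_ge_0 (a - a')). pose proof (pow2_ge_0 (b - b')). lra.
  - pose proof (Hmax p0 ltac:(lra)) as Q. rewrite !ReW in Q.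
    specialize (Hb' p ltac:(lra)).
    assert (Cmod p ^ 2 <= 1) by (simpl; nra).
    assert (0 <= Cmod p0 ^ 2) by apply pow2_ge_0.
    unfold eta in *. nra.
Qed.

(** * The pseudo-hyperbolic distance and the Schwarz-Pick lemma *)

(* Pseudo-hyperbolic distance: hyp_dist z w = artanh (pd z w). *)
Definition pd (z w : C) : R := Cmod ((z - w) / (1 - Cconj w * z))%C.

Lemma Cmod_lt1_den (z w : C) : Cmod w < 1 -> Cmod z <= 1 -> (1 - Cconj w * z <> 0)%C.
Proof.
  intros Hw Hz H.
  assert (E : (Cconj w * z = 1)%C).
  { symmetry. apply Cminus_0_eq. rewrite H. apply Cmod_0. }
  apply (f_equal Cmod) in E. rewrite Cmod_mult, Cmod_conj, Cmod_1 in E.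
  pose proof (Cmod_ge_0 w). pose proof (Cmod_ge_0 z). nra.
Qed.

Lemma Cmod_den_ge (z w : C) : 1 - Cmod w * Cmod z <= Cmod (1 - Cconj w * z)%C.
Proof.
  pose proof (Cmod_triangle_rev 1 (Cconj w * z)) as H.
  rewrite Cmod_1, Cmod_mult, Cmod_conj in H. exact H.
Qed.

Lemma Cmod_den_sym (z w : C) : Cmod (1 - Cconj w * z)%C = Cmod (1 - Cconj z * w)%C.
Proof.
  rewrite <- Cmod_conj. f_equal. rewrite Cminus_conj, Cmult_conj, Cconj_conj.
  replace (Cconj 1) with (RtoC 1) by (apply injective_projections; simpl; ring). ring.
Qed.

Lemma Cmod_den_identity (z w : C) :
  Cmod (1 - Cconj w * z)%C ^ 2 - Cmod (z - w)%C ^ 2 = (1 - Cmod z ^ 2) * (1 - Cmod w ^ 2).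
Proof. rewrite !Cmod2. destruct z, w. simpl. ring. Qed.

Lemma Cmod_den_refl (a : C) : (1 - Cconj a * a)%C = RtoC (1 - Cmod a ^ 2).
Proof. rewrite Cmod2. destruct a. apply injective_projections; simpl; ring. Qed.

Lemma pd_spec (z w : C) : Cmod z < 1 -> Cmod w < 1 ->
  0 < Cmod (1 - Cconj w * z)%C /\ pd z w * Cmod (1 - Cconj w * z)%C = Cmod (z - w)%C.
Proof.
  intros Hz Hw. pose proof (Cmod_lt1_den z w Hw (Rlt_le _ _ Hz)) as N.
  assert (P : 0 < Cmod (1 - Cconj w * z)%C) by now apply Cmod_gt_0.
  split; [exact P|]. unfold pd. rewrite Cmod_div by exact N. field. lra.
Qed.

Lemma pd_ge_0 (z w : C) : 0 <= pd z w.
Proof. apply Cmod_ge_0. Qed.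

Lemma pd_sym (z w : C) : Cmod z < 1 -> Cmod w < 1 -> pd z w = pd w z.
Proof.
  intros Hz Hw. destruct (pd_spec z w Hz Hw) as [P E]. destruct (pd_spec w z Hw Hz) as [P' E'].
  rewrite Cmod_den_sym in E'. rewrite (Cmod_minus_sym w z) in E'.
  apply Rmult_eq_reg_r with (Cmod (1 - Cconj w * z)%C); lra.
Qed.

Lemma pd_identity (z w : C) : Cmod z < 1 -> Cmod w < 1 ->
  (1 - pd z w ^ 2) * Cmod (1 - Cconj w * z)%C ^ 2 = (1 - Cmod z ^ 2) * (1 - Cmod w ^ 2).
Proof.
  intros Hz Hw. destruct (pd_spec z w Hz Hw) as [_ E].
  rewrite <- Cmod_den_identity, <- E. ring.
Qed.

Lemma one_minus_sq_pos (z : C) : Cmod z < 1 -> 0 < 1 - Cmod z ^ 2.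
Proof. intros H. pose proof (Cmod_ge_0 z). nra. Qed.

Lemma pd_lt_1 (z w : C) : Cmod z < 1 -> Cmod w < 1 -> pd z w < 1.
Proof.
  intros Hz Hw. pose proof (pd_identity z w Hz Hw) as E.
  destruct (pd_spec z w Hz Hw) as [P _].
  pose proof (one_minus_sq_pos z Hz). pose proof (one_minus_sq_pos w Hw).
  assert (0 < (1 - Cmod z ^ 2) * (1 - Cmod w ^ 2)) by now apply Rmult_lt_0_compat.
  assert (0 < Cmod (1 - Cconj w * z)%C ^ 2) by now apply pow_lt.
  apply Rnot_le_lt. intros h. assert (1 - pd z w ^ 2 <= 0) by nra. nra.
Qed.

Lemma pd_pos (z w : C) : Cmod z < 1 -> Cmod w < 1 -> z <> w -> 0 < pd z w.
Proof.
  intros Hz Hw Hne. destruct (pd_spec z w Hz Hw) as [P E].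
  pose proof (Cmod_minus_pos z w Hne). pose proof (pd_ge_0 z w). nra.
Qed.

Lemma pd_refl (z : C) : pd z z = 0.
Proof.
  unfold pd. replace ((z - z) / (1 - Cconj z * z))%C with (RtoC 0).
  - apply Cmod_0.
  - unfold Cdiv. ring.
Qed.

(** With t = n / m: taking moduli does not increase the pseudo-hyperbolic distance, so a bound t for
    A, B passes to |A|, |B|. This follows from 1 - |A||B| <= |1 - conj(B) A| and
    [Cmod_den_identity], whose right side depends on moduli only. The form without quotients admits
    points of the unit circle. *)
Lemma Cmod_gap (A B : C) (m n : R) :
  Cmod A <= 1 -> Cmod B <= 1 -> 0 <= n -> n < m ->
  Cmod (A - B)%C * m <= Cmod (1 - Cconj B * A)%C * n ->
  Rabs (Cmod A - Cmod B) * m <= n * (1 - Cmod A * Cmod B).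
Proof.
  intros HA HB Hn Hm H.
  pose proof (Cmod_den_identity A B) as E. pose proof (Cmod_den_ge A B) as G.
  pose proof (Cmod_ge_0 A). pose proof (Cmod_ge_0 B). pose proof (Cmod_ge_0 (A - B)).
  set (X := Cmod (1 - Cconj B * A)%C) in *. set (a := Cmod A) in *. set (b := Cmod B) in *.
  set (D := Cmod (A - B)%C) in *.
  assert (HX : 0 <= X) by apply Cmod_ge_0.
  assert (HY : 0 <= 1 - a * b) by nra.
  assert (Hsq : (D * m) ^ 2 <= (X * n) ^ 2) by (apply pow_incr; split; [nra | exact H]).
  assert (HYX : (1 - a * b) ^ 2 <= X ^ 2) by (apply pow_incr; lra).
  assert (Hmn : 0 <= m ^ 2 - n ^ 2) by nra.
  assert (F : (1 - a * b) ^ 2 * (m ^ 2 - n ^ 2) <= m ^ 2 * ((1 - a ^ 2) * (1 - b ^ 2))).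
  { apply Rle_trans with (X ^ 2 * (m ^ 2 - n ^ 2)); [now apply Rmult_le_compat_r|].
    rewrite <- E. rewrite !Rpow_mult_distr in Hsq. lra. }
  assert (Hm0 : 0 <= m) by lra. assert (HnY : 0 <= n * (1 - a * b)) by nra.
  rewrite <- (Rabs_pos_eq m Hm0), <- Rabs_mult, <- (Rabs_pos_eq _ HnY).
  apply Rsqr_le_abs_0. rewrite !Rsqr_pow2. nra.
Qed.

Lemma pd_Cmod (z w : C) : Cmod z < 1 -> Cmod w < 1 ->
  Rabs (Cmod z - Cmod w) <= pd z w * (1 - Cmod z * Cmod w).
Proof.
  intros Hz Hw. pose proof (pd_lt_1 z w Hz Hw) as L. pose proof (pd_ge_0 z w).
  rewrite <- (Rmult_1_r (Rabs _)).
  apply Cmod_gap; try lra. destruct (pd_spec z w Hz Hw) as [_ E]. lra.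
Qed.

(* For k the difference quotient of f at a, its modulus is
   pd (f z) (f a) / pd z a, continued to z = a by the hyperbolic derivative. *)
Definition hyp_quot (f k : C -> C) (a z : C) : C :=
  (k z * (1 - Cconj a * z) / (1 - Cconj (f a) * f z))%C.

Section Hyp_quot.

Variables (f k : C -> C) (a : C).
Hypotheses (Ha : Cmod a < 1) (Hf1 : forall z, Cmod z < 1 -> Cmod (f z) <= 1)
  (Hfa : Cmod (f a) < 1) (Hk : diff_quot f a k).

Lemma hyp_quot_den (z : C) : Cmod z < 1 -> (1 - Cconj (f a) * f z <> 0)%C.
Proof. intros Hz. apply Cmod_lt1_den; [exact Hfa | now apply Hf1]. Qed.

Lemma hyp_quot_spec (z : C) : Cmod z < 1 ->
  Cmod (hyp_quot f k a z) * (Cmod (1 - Cconj (f a) * f z) * Cmod (z - a)) =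
  Cmod (f z - f a) * Cmod (1 - Cconj a * z).
Proof.
  intros Hz. destruct Hk as [_ E]. rewrite E, <- !Cmod_mult. f_equal.
  unfold hyp_quot. field. now apply hyp_quot_den.
Qed.

Lemma hyp_quot_cont_center : cont_at f a -> cont_at (hyp_quot f k a) a.
Proof.
  intros Cf. apply cont_at_div.
  - apply cont_at_mult; [apply Hk|]. apply cont_at_minus; [apply cont_at_const|].
    apply cont_at_mult; [apply cont_at_const | apply cont_at_id].
  - apply cont_at_minus; [apply cont_at_const|].
    apply cont_at_mult; [apply cont_at_const | exact Cf].
  - now apply hyp_quot_den.
Qed.

(** Away from a the factor k is the plain difference quotient, so [hyp_quot] inherits continuity and
    differentiability from f there. *)
Lemma hyp_quot_off_center (p : C) : p <> a -> forall z, Cmod (z - p) < Cmod (p - a) ->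
  ((f z - f a) / (z - a) * (1 - Cconj a * z) / (1 - Cconj (f a) * f z))%C = hyp_quot f k a z.
Proof.
  intros Hp z Hz. unfold hyp_quot. do 2 f_equal. destruct Hk as [_ E]. rewrite E. field.
  intros h. rewrite (Cminus_0_eq z a) in Hz by (rewrite h; apply Cmod_0).
  rewrite Cmod_minus_sym in Hz. lra.
Qed.

Lemma hyp_quot_cont (p : C) : Cmod p < 1 -> p <> a -> cont_at f p -> cont_at (hyp_quot f k a) p.
Proof.
  intros Hp Hpa Cf. pose proof (Cmod_minus_pos p a Hpa) as P.
  apply cont_at_ext_loc with (1 := P) (2 := hyp_quot_off_center p Hpa).
  apply cont_at_div; [apply cont_at_mult; [apply cont_at_div|]|..].
  - apply cont_at_minus; [exact Cf | apply cont_at_const].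
  - apply cont_at_minus; [apply cont_at_id | apply cont_at_const].
  - now apply Cmod_gt_0.
  - apply cont_at_minus; [apply cont_at_const|].
    apply cont_at_mult; [apply cont_at_const | apply cont_at_id].
  - apply cont_at_minus; [apply cont_at_const|].
    apply cont_at_mult; [apply cont_at_const | exact Cf].
  - now apply hyp_quot_den.
Qed.

Lemma hyp_quot_diff (p : C) : Cmod p < 1 -> p <> a -> diff_at f p -> diff_at (hyp_quot f k a) p.
Proof.
  intros Hp Hpa Df. pose proof (Cmod_minus_pos p a Hpa) as P.
  apply diff_at_ext_loc with (1 := P) (2 := hyp_quot_off_center p Hpa).
  apply diff_at_div; [apply diff_at_mult; [apply diff_at_div|]|..].
  - apply diff_at_minus; [exact Df | apply diff_at_const].
  - apply diff_at_minus; [apply diff_at_id | apply diff_at_const].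
  - now apply Cmod_gt_0.
  - apply diff_at_minus; [apply diff_at_const|].
    apply diff_at_mult; [apply diff_at_const | apply diff_at_id].
  - apply diff_at_minus; [apply diff_at_const|].
    apply diff_at_mult; [apply diff_at_const | exact Df].
  - now apply hyp_quot_den.
Qed.

Lemma hyp_quot_near_holo : near_holo f -> near_holo (hyp_quot f k a).
Proof.
  intros Hf p Hp. destruct (Hf p Hp) as [Cf [r [Hr Df]]].
  destruct (excluded_middle_informative (p = a)) as [->|Hpa].
  - split; [now apply hyp_quot_cont_center|].
    exists (Rmin r (1 - Cmod a)). split; [apply Rmin_pos; lra|]. intros z [Hz Hz'].
    pose proof (Rmin_l r (1 - Cmod a)). pose proof (Rmin_r r (1 - Cmod a)).
    pose proof (Cmod_triangle_rev z a).
    apply hyp_quot_diff; [lra | | apply Df; lra].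
    intros ->. replace (a - a)%C with (RtoC 0) in Hz by ring. rewrite Cmod_0 in Hz. lra.
  - split; [now apply hyp_quot_cont|].
    pose proof (Cmod_minus_pos p a Hpa) as P.
    exists (Rmin r (Rmin (1 - Cmod p) (Cmod (p - a)))).
    split; [repeat apply Rmin_pos; lra|]. intros z [Hz Hz'].
    pose proof (Rmin_l r (Rmin (1 - Cmod p) (Cmod (p - a)))).
    pose proof (Rmin_r r (Rmin (1 - Cmod p) (Cmod (p - a)))).
    pose proof (Rmin_l (1 - Cmod p) (Cmod (p - a))). pose proof (Rmin_r (1 - Cmod p) (Cmod (p - a))).
    pose proof (Cmod_triangle_rev z p).
    apply hyp_quot_diff; [lra | | apply Df; lra].
    intros ->. rewrite Cmod_minus_sym in Hz'. lra.
Qed.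

(** Writing the modulus as (Y / X) * (B / D), the first factor is at most 1 because f maps into the
    closed disc, and B^2 - D^2 = (1 - |z|^2)(1 - |a|^2) tends to 0 at the unit circle. The maximum
    principle does the rest. *)
Lemma hyp_quot_le_1 : near_holo f -> forall z, Cmod z < 1 -> Cmod (hyp_quot f k a z) <= 1.
Proof.
  intros Hf. apply max_principle; [now apply hyp_quot_near_holo|].
  (* So that 1 - kap = / (1 + eps). *)
  intros eps He. set (kap := eps / (1 + eps)).
  assert (Hkap : 0 < kap < 1).
  { unfold kap. split; [apply Rdiv_lt_0_compat; lra|].
    apply Rmult_lt_reg_r with (1 + eps); [lra|]. unfold Rdiv. rewrite Rmult_assoc, Rinv_l; lra. }
  pose proof (Cmod_ge_0 a) as A0.
  (* Beyond this radius (1 - |z|^2)(1 - |a|^2) <= 2 (1 - |z|) <= kap * (1 - |a|)^2 <= kap * B^2. *)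
  exists (1 - kap * (1 - Cmod a) ^ 2 / 2). split.
  { assert (0 < kap * (1 - Cmod a) ^ 2) by (apply Rmult_lt_0_compat; [lra | apply pow_lt; lra]). lra. }
  intros z [Hz Hz1].
  pose proof (hyp_quot_spec z Hz1) as S.
  pose proof (Cmod_den_identity (f z) (f a)) as I1.
  pose proof (Cmod_den_identity z a) as I2.
  pose proof (Cmod_den_ge z a) as G.
  pose proof (Hf1 z Hz1) as F1. pose proof (Cmod_ge_0 (f z)) as F0.
  pose proof (Cmod_ge_0 (f a)) as Fa0. pose proof (Cmod_ge_0 z) as Z0.
  assert (N0 : 0 < Cmod (1 - Cconj (f a) * f z)) by (apply Cmod_gt_0; now apply hyp_quot_den).
  set (Q := Cmod (hyp_quot f k a z)) in *.
  set (X := Cmod (1 - Cconj (f a) * f z)) in *. set (B := Cmod (1 - Cconj a * z)) in *.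
  set (Y := Cmod (f z - f a)) in *. set (D := Cmod (z - a)) in *.
  assert (Q0 : 0 <= Q) by apply Cmod_ge_0.
  assert (D0 : 0 <= D) by apply Cmod_ge_0.
  assert (B1 : 1 - Cmod a <= B) by nra.
  assert (YX : Y ^ 2 <= X ^ 2).
  { assert (0 <= (1 - Cmod (f z) ^ 2) * (1 - Cmod (f a) ^ 2)) by (apply Rmult_le_pos; nra). lra. }
  assert (QD : Q ^ 2 * D ^ 2 <= B ^ 2).
  { apply Rmult_le_reg_l with (X ^ 2); [now apply pow_lt|].
    replace (X ^ 2 * (Q ^ 2 * D ^ 2)) with ((Q * (X * D)) ^ 2) by ring. rewrite S.
    rewrite Rpow_mult_distr. apply Rmult_le_compat_r; [apply pow2_ge_0 | exact YX]. }
  assert (DB : (1 - kap) * B ^ 2 <= D ^ 2).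
  { assert (kap * (1 - Cmod a) ^ 2 <= kap * B ^ 2).
    { apply Rmult_le_compat_l; [lra|]. apply pow_incr. lra. }
    assert ((1 - Cmod z ^ 2) * (1 - Cmod a ^ 2) <= 2 * (1 - Cmod z)).
    { replace (2 * (1 - Cmod z)) with ((2 * (1 - Cmod z)) * 1) by ring.
      apply Rmult_le_compat; nra. }
    lra. }
  assert (QQ : Q ^ 2 * ((1 - kap) * B ^ 2) <= B ^ 2).
  { eapply Rle_trans; [|exact QD]. apply Rmult_le_compat_l; [apply pow2_ge_0 | exact DB]. }
  assert (B2 : 0 < B ^ 2) by (apply pow_lt; lra).
  assert (QK : Q ^ 2 * (1 - kap) <= 1).
  { apply Rmult_le_reg_r with (B ^ 2); [exact B2 | lra]. }
  assert (E1 : 1 - kap = / (1 + eps)) by (unfold kap; field; lra).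
  rewrite E1 in QK. apply Rmult_le_reg_r with (/ (1 + eps)).
  - apply Rinv_0_lt_compat. lra.
  - rewrite Rinv_r; lra.
Qed.

Lemma schwarz_pick_mult : near_holo f -> forall z, Cmod z < 1 ->
  Cmod (f z - f a) * Cmod (1 - Cconj a * z) <= Cmod (1 - Cconj (f a) * f z) * Cmod (z - a).
Proof.
  intros Hf z Hz. rewrite <- hyp_quot_spec by exact Hz.
  rewrite <- (Rmult_1_l (_ * Cmod (z - a))) at 2.
  apply Rmult_le_compat_r; [|now apply hyp_quot_le_1].
  apply Rmult_le_pos; apply Cmod_ge_0.
Qed.

End Hyp_quot.

Lemma holo_near_holo (f : C -> C) : (forall z, Cmod z < 1 -> diff_at f z) -> near_holo f.
Proof.
  intros H p Hp. split; [now apply diff_at_cont, H|].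
  exists (1 - Cmod p). split; [lra|]. intros z [_ Hz]. apply H.
  pose proof (Cmod_triangle_rev z p). lra.
Qed.

Lemma cont_at_Cmod (f : C -> C) (p : C) : cont_at f p -> cont_at (fun z => RtoC (Cmod (f z))) p.
Proof.
  intros Hf eps He. destruct (Hf eps He) as [e [H1 H2]]. exists e. split; [exact H1|].
  intros z Hz. specialize (H2 z Hz). rewrite <- RtoC_minus, Cmod_R.
  apply Rabs_lt_between.
  pose proof (Cmod_triangle_rev (f z) (f p)). pose proof (Cmod_triangle_rev (f p) (f z)) as T.
  rewrite Cmod_minus_sym in T. lra.
Qed.

Lemma cont_at_le_limit (F : C -> C) (a : C) (r : R) :
  0 < r -> cont_at F a -> (forall c, c <> a -> Cmod (c - a) < r -> Re (F c) <= 0) -> Re (F a) <= 0.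
Proof.
  intros Hr HF H. apply Rnot_lt_le. intros h.
  destruct (HF (Re (F a)) h) as [e [He HFe]].
  set (t := Rmin (e / 2) (r / 2)).
  assert (Ht : 0 < t) by (apply Rmin_pos; lra).
  assert (Hc : Cmod (a + RtoC t - a)%C = t).
  { replace (a + RtoC t - a)%C with (RtoC t) by ring. rewrite Cmod_R. apply Rabs_pos_eq. lra. }
  pose proof (Rmin_l (e / 2) (r / 2)) as T1. pose proof (Rmin_r (e / 2) (r / 2)) as T2.
  fold t in T1, T2.
  specialize (HFe (a + RtoC t)%C ltac:(lra)).
  assert (Q : Re (F (a + RtoC t)%C) <= 0).
  { apply H; [|lra]. intros h'. rewrite h' in Hc.
    replace (a - a)%C with (RtoC 0) in Hc by ring. rewrite Cmod_0 in Hc. lra. }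
  pose proof (Re_minus_le (F (a + RtoC t)%C) (F a)) as P.
  apply Rabs_le_between in P. lra.
Qed.

(* Schwarz-Pick for the hyperbolic quotient itself, first at centres c <> a,
   where the quotient is differentiable, and then in the limit c -> a. *)
Lemma hyp_quot_gap (f k : C -> C) (a z : C) :
  (forall w, Cmod w < 1 -> diff_at f w) -> (forall w, Cmod w < 1 -> Cmod (f w) < 1) ->
  Cmod a < 1 -> Cmod z < 1 -> z <> a -> diff_quot f a k ->
  Rabs (Cmod (hyp_quot f k a z) - Cmod (hyp_quot f k a a)) <=
  pd z a * (1 - Cmod (hyp_quot f k a z) * Cmod (hyp_quot f k a a)).
Proof.
  intros Df Hf Ha Hz Hza Hk. set (q := hyp_quot f k a).
  assert (Hf1 : forall w, Cmod w < 1 -> Cmod (f w) <= 1) by (intros w Hw; left; now apply Hf).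
  pose proof (holo_near_holo f Df) as Nf.
  assert (Nq : near_holo q) by (apply hyp_quot_near_holo; auto).
  assert (Q1 : forall w, Cmod w < 1 -> Cmod (q w) <= 1) by (apply hyp_quot_le_1; auto).
  assert (Dq : forall w, Cmod w < 1 -> w <> a -> diff_at q w).
  { intros w Hw Hwa. apply hyp_quot_diff; auto. }
  assert (SP : forall c w, Cmod c < 1 -> Cmod w < 1 -> c <> a -> Cmod (q c) < 1 ->
    Rabs (Cmod (q w) - Cmod (q c)) * Cmod (1 - Cconj c * w) <=
    Cmod (w - c) * (1 - Cmod (q w) * Cmod (q c))).
  { intros c w Hc Hw Hca Hqc. destruct (Dq c Hc Hca) as [k' Hk'].
    destruct (pd_spec w c Hw Hc) as [P E]. pose proof (pd_lt_1 w c Hw Hc).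
    apply Cmod_gap; auto; [apply Cmod_ge_0 | nra |].
    now apply schwarz_pick_mult with (k := k'). }
  assert (SPc : forall c, Cmod c < 1 -> c <> a ->
    Rabs (Cmod (q z) - Cmod (q c)) * Cmod (1 - Cconj c * z) <=
    Cmod (z - c) * (1 - Cmod (q z) * Cmod (q c))).
  { intros c Hc Hca.
    (* [SP] needs the value at its centre inside the open disc. If |q c| = 1, the roles of c and z
       are exchanged; if |q z| = 1 too, both sides vanish. *)
    destruct (Rle_lt_or_eq_dec _ _ (Q1 c Hc)) as [h|h]; [now apply SP|].
    destruct (Rle_lt_or_eq_dec _ _ (Q1 z Hz)) as [h'|h'].
    - pose proof (SP z c Hz Hc Hza h') as S.
      rewrite Rabs_minus_sym, Cmod_den_sym, (Cmod_minus_sym c z) in S.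
      rewrite (Rmult_comm (Cmod (q z))). exact S.
    - rewrite h, h', Rminus_diag, Rabs_R0. lra. }
  set (F := fun c => (RtoC (Cmod (RtoC (Cmod (q z)) - RtoC (Cmod (q c)))) * RtoC (Cmod (1 - Cconj c * z))
       - RtoC (Cmod (z - c)) * (1 - RtoC (Cmod (q z)) * RtoC (Cmod (q c))))%C).
  assert (ReF : forall c, Re (F c) = Rabs (Cmod (q z) - Cmod (q c)) * Cmod (1 - Cconj c * z) -
      Cmod (z - c) * (1 - Cmod (q z) * Cmod (q c))).
  { intros c. unfold F. rewrite <- RtoC_minus, Cmod_R. simpl. ring. }
  assert (CF : cont_at F a).
  { assert (Cq : cont_at q a) by apply (Nq a Ha).
    apply cont_at_minus; apply cont_at_mult.
    - apply cont_at_Cmod, cont_at_minus; [apply cont_at_const | now apply cont_at_Cmod].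
    - apply cont_at_Cmod, cont_at_minus; [apply cont_at_const|].
      apply cont_at_mult; [apply cont_at_conj, cont_at_id | apply cont_at_const].
    - apply cont_at_Cmod, cont_at_minus; [apply cont_at_const | apply cont_at_id].
    - apply cont_at_minus; [apply cont_at_const|].
      apply cont_at_mult; [apply cont_at_const | now apply cont_at_Cmod]. }
  assert (L : Re (F a) <= 0).
  { apply cont_at_le_limit with (r := 1 - Cmod a); [lra | exact CF |].
    intros c Hca Hc. rewrite ReF. pose proof (Cmod_triangle_rev c a).
    specialize (SPc c ltac:(lra) Hca). lra. }
  rewrite ReF in L. destruct (pd_spec z a Hz Ha) as [P E].
  apply Rmult_le_reg_r with (1 := P). rewrite <- E in L. lra.
Qed.

(** * Hyperbolic derivatives along orbits *)

Definition disc_map (f : C -> C) : Prop :=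
  (forall z, Cmod z < 1 -> Cmod (f z) < 1) /\ (forall z, Cmod z < 1 -> diff_at f z).

Lemma holomorphic_disc_map (f : C -> C) : holomorphic_self_map f -> disc_map f.
Proof.
  intros [H1 H2]. split; [exact H1|]. intros z Hz. destruct (H2 z Hz) as [d Hd].
  destruct (is_derive_diff_quot f z d Hd) as [k [Hk _]]. now exists k.
Qed.

Lemma disc_map_iter (f : C -> C) (n : nat) : disc_map f -> disc_map (Nat.iter n f).
Proof.
  intros [H1 H2]. induction n as [|n [I1 I2]]; split; intros z Hz; simpl.
  - exact Hz.
  - apply diff_at_id.
  - now apply H1, I1.
  - apply (diff_at_comp (Nat.iter n f) f); [now apply I2 | now apply H2, I1].
Qed.

Lemma disc_map_iter_lt_1 (f : C -> C) (n : nat) (z : C) :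
  disc_map f -> Cmod z < 1 -> Cmod (Nat.iter n f z) < 1.
Proof. intros Hf. apply (disc_map_iter f n Hf). Qed.

Definition hyp_derive (f : C -> C) (z : C) : R :=
  Cmod (C_derive f z) * (1 - Cmod z ^ 2) / (1 - Cmod (f z) ^ 2).

Lemma hyp_quot_center (f k : C -> C) (a : C) :
  Cmod a < 1 -> Cmod (f a) < 1 -> diff_quot f a k ->
  Cmod (hyp_quot f k a a) = hyp_derive f a.
Proof.
  intros Ha Hfa Hk. unfold hyp_quot, hyp_derive.
  pose proof (one_minus_sq_pos a Ha). pose proof (one_minus_sq_pos (f a) Hfa) as P.
  rewrite !Cmod_den_refl, Cmod_div, Cmod_mult, !Cmod_R, !Rabs_pos_eq by
    (try lra; intros h; apply RtoC_inj in h; lra).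
  rewrite (diff_quot_C_derive f k a Hk). reflexivity.
Qed.

Lemma hyp_derive_range (f : C -> C) (a : C) :
  disc_map f -> Cmod a < 1 -> 0 <= hyp_derive f a <= 1.
Proof.
  intros [H1 H2] Ha. destruct (H2 a Ha) as [k Hk].
  rewrite <- (hyp_quot_center f k a Ha (H1 a Ha) Hk). split; [apply Cmod_ge_0|].
  apply hyp_quot_le_1; auto; [intros z Hz; left; auto | now apply holo_near_holo].
Qed.

Lemma two_point_schwarz_pick (f : C -> C) (a z : C) :
  disc_map f -> Cmod a < 1 -> Cmod z < 1 -> z <> a ->
  exists y, 0 <= y <= 1 /\ pd (f z) (f a) = y * pd z a /\
    Rabs (y - hyp_derive f a) <= pd z a * (1 - y * hyp_derive f a).
Proof.
  intros [H1 H2] Ha Hz Hza. destruct (H2 a Ha) as [k Hk].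
  assert (H1' : forall w, Cmod w < 1 -> Cmod (f w) <= 1) by (intros w Hw; left; auto).
  exists (Cmod (hyp_quot f k a z)). split; [split|split].
  - apply Cmod_ge_0.
  - apply hyp_quot_le_1; auto. now apply holo_near_holo.
  - pose proof (hyp_quot_spec f k a H1' (H1 a Ha) Hk z Hz) as S.
    destruct (pd_spec z a Hz Ha) as [P E].
    destruct (pd_spec (f z) (f a) (H1 z Hz) (H1 a Ha)) as [P' E'].
    apply Rmult_eq_reg_r with (Cmod (1 - Cconj (f a) * f z) * Cmod (1 - Cconj a * z)).
    + rewrite <- Rmult_assoc, E', <- S, <- E. ring.
    + apply Rgt_not_eq, Rmult_lt_0_compat; assumption.
  - rewrite <- (hyp_quot_center f k a Ha (H1 a Ha) Hk). now apply hyp_quot_gap.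
Qed.

Lemma pd_contract (f : C -> C) (a z : C) :
  disc_map f -> Cmod a < 1 -> Cmod z < 1 -> pd (f z) (f a) <= pd z a.
Proof.
  intros Hf Ha Hz. destruct (excluded_middle_informative (z = a)) as [->|Hza].
  - rewrite !pd_refl. lra.
  - destruct (two_point_schwarz_pick f a z Hf Ha Hz Hza) as [y [Hy [E _]]].
    rewrite E. pose proof (pd_ge_0 z a). nra.
Qed.

(** The gap estimate bounds the ratio y below by c - pd z a, hence by c / 2. *)
Lemma pd_expand (f : C -> C) (a z : C) (c : R) :
  disc_map f -> Cmod a < 1 -> Cmod z < 1 -> z <> a ->
  c <= hyp_derive f a -> pd z a <= c / 2 -> c / 2 * pd z a <= pd (f z) (f a).
Proof.
  intros Hf Ha Hz Hza Hc Hp.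
  destruct (two_point_schwarz_pick f a z Hf Ha Hz Hza) as [y [Hy [E G]]]. rewrite E.
  pose proof (hyp_derive_range f a Hf Ha). pose proof (pd_ge_0 z a).
  apply Rabs_le_between in G. apply Rmult_le_compat_r; [lra|].
  assert (0 <= pd z a * (y * hyp_derive f a)) by (apply Rmult_le_pos; [lra | apply Rmult_le_pos; lra]). lra.
Qed.

(** By symmetry of [pd] the ratio y is the same for both centres, and each hyperbolic derivative
    lies within pd z a of it. This gives an explicit ball on which a positive hyperbolic derivative
    stays positive. *)
Lemma hyp_derive_lipschitz (f : C -> C) (a z : C) :
  disc_map f -> Cmod a < 1 -> Cmod z < 1 -> hyp_derive f a - hyp_derive f z <= 2 * pd z a.
Proof.
  intros Hf Ha Hz. destruct (excluded_middle_informative (z = a)) as [->|Hza].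
  - rewrite pd_refl. lra.
  - destruct (two_point_schwarz_pick f a z Hf Ha Hz Hza) as [y [Hy [E G]]].
    destruct (two_point_schwarz_pick f z a Hf Hz Ha (fun h => Hza (eq_sym h))) as [y' [Hy' [E' G']]].
    destruct Hf as [Hf1 Hf2].
    rewrite (pd_sym (f a) (f z)), (pd_sym a z) in E' by auto.
    rewrite (pd_sym a z) in G' by auto.
    pose proof (pd_pos z a Hz Ha Hza) as P.
    assert (y' = y) by (apply Rmult_eq_reg_r with (pd z a); lra). subst y'.
    pose proof (hyp_derive_range f a (conj Hf1 Hf2) Ha).
    pose proof (hyp_derive_range f z (conj Hf1 Hf2) Hz).
    apply Rabs_le_between in G, G'.
    assert (0 <= pd z a * (y * hyp_derive f a)) by (apply Rmult_le_pos; [lra | apply Rmult_le_pos; lra]).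
    assert (0 <= pd z a * (y * hyp_derive f z)) by (apply Rmult_le_pos; [lra | apply Rmult_le_pos; lra]).
    lra.
Qed.

Lemma hyp_derive_comp (f g : C -> C) (a : C) :
  disc_map f -> disc_map g -> Cmod a < 1 ->
  hyp_derive (fun z => g (f z)) a = hyp_derive g (f a) * hyp_derive f a.
Proof.
  intros [F1 F2] [G1 G2] Ha. destruct (F2 a Ha) as [k Hk]. destruct (G2 (f a) (F1 a Ha)) as [l Hl].
  unfold hyp_derive. rewrite (diff_quot_C_derive _ _ _ (diff_quot_comp f g k l a Hk Hl)).
  rewrite (diff_quot_C_derive f k a Hk), (diff_quot_C_derive g l (f a) Hl), Cmod_mult.
  pose proof (one_minus_sq_pos _ (F1 a Ha)). pose proof (one_minus_sq_pos _ (G1 _ (F1 a Ha))).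
  field. lra.
Qed.

Lemma hyp_derive_id (z : C) : Cmod z < 1 -> hyp_derive (fun w => w) z = 1.
Proof.
  intros Hz. unfold hyp_derive. rewrite (diff_quot_C_derive (fun w => w) (fun _ => RtoC 1)).
  - rewrite Cmod_1. pose proof (one_minus_sq_pos z Hz). field. lra.
  - split; [apply cont_at_const | intros; ring].
Qed.

Lemma hyp_derive_iter_add (f : C -> C) (m n : nat) (z : C) :
  disc_map f -> Cmod z < 1 ->
  hyp_derive (Nat.iter (m + n) f) z =
  hyp_derive (Nat.iter m f) (Nat.iter n f z) * hyp_derive (Nat.iter n f) z.
Proof.
  intros Hf Hz. rewrite <- hyp_derive_comp; [|now apply disc_map_iter..|exact Hz].
  f_equal. apply functional_extensionality. intros w. apply Nat.iter_add.
Qed.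

Lemma hyp_derive_iter_decr (f : C -> C) (m n : nat) (z : C) :
  disc_map f -> Cmod z < 1 -> (n <= m)%nat ->
  hyp_derive (Nat.iter m f) z <= hyp_derive (Nat.iter n f) z.
Proof.
  intros Hf Hz Hnm. replace m with ((m - n) + n)%nat by lia. rewrite hyp_derive_iter_add by assumption.
  pose proof (hyp_derive_range _ z (disc_map_iter f n Hf) Hz).
  pose proof (hyp_derive_range _ _ (disc_map_iter f (m - n) Hf) (disc_map_iter_lt_1 f n z Hf Hz)).
  nra.
Qed.

Lemma pd_iter_decr (f : C -> C) (m n : nat) (z w : C) :
  disc_map f -> Cmod z < 1 -> Cmod w < 1 -> (n <= m)%nat ->
  pd (Nat.iter m f z) (Nat.iter m f w) <= pd (Nat.iter n f z) (Nat.iter n f w).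
Proof.
  intros Hf Hz Hw Hnm. replace m with ((m - n) + n)%nat by lia. rewrite !Nat.iter_add.
  apply pd_contract; [now apply disc_map_iter | now apply disc_map_iter_lt_1..].
Qed.

(** One small term is enough: the distances are nonincreasing in n by Schwarz-Pick, so they tend to
    0. The same holds for [hyp_derive_vanishes] by the chain rule. *)
Definition merging (f : C -> C) (z w : C) : Prop :=
  forall eps, 0 < eps -> exists n, pd (Nat.iter n f z) (Nat.iter n f w) < eps.

Definition hyp_derive_vanishes (f : C -> C) (z : C) : Prop :=
  forall eps, 0 < eps -> exists n, hyp_derive (Nat.iter n f) z < eps.

Lemma not_merging (f : C -> C) (z w : C) :
  ~ merging f z w -> exists d, 0 < d /\ forall n, d <= pd (Nat.iter n f z) (Nat.iter n f w).
Proof.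
  intros H. apply NNPP. intros Hno. apply H. intros eps He. apply NNPP. intros Hn.
  apply Hno. exists eps. split; [exact He|]. intros n. apply Rnot_lt_le. intros h. apply Hn. now exists n.
Qed.

Lemma not_hyp_derive_vanishes (f : C -> C) (z : C) :
  ~ hyp_derive_vanishes f z -> exists c, 0 < c /\ forall n, c <= hyp_derive (Nat.iter n f) z.
Proof.
  intros H. apply NNPP. intros Hno. apply H. intros eps He. apply NNPP. intros Hn.
  apply Hno. exists eps. split; [exact He|]. intros n. apply Rnot_lt_le. intros h. apply Hn. now exists n.
Qed.

Lemma merging_sym (f : C -> C) (z w : C) :
  disc_map f -> Cmod z < 1 -> Cmod w < 1 -> merging f z w -> merging f w z.
Proof.
  intros Hf Hz Hw H eps He. destruct (H eps He) as [n Hn]. exists n.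
  rewrite pd_sym; [exact Hn | now apply disc_map_iter_lt_1..].
Qed.

Lemma merging_tail (f : C -> C) (z w : C) (n : nat) :
  disc_map f -> Cmod z < 1 -> Cmod w < 1 ->
  merging f z w <-> merging f (Nat.iter n f z) (Nat.iter n f w).
Proof.
  intros Hf Hz Hw. split; intros H eps He; destruct (H eps He) as [m Hm].
  - exists m. rewrite <- !Nat.iter_add.
    eapply Rle_lt_trans; [|exact Hm]. apply pd_iter_decr; auto. lia.
  - exists (m + n)%nat. rewrite !Nat.iter_add. exact Hm.
Qed.

(* If d(f^n w, f^n z) decreases to a positive limit, its successive ratios have
   a positive product, and the two-point Schwarz-Pick lemma transfers this to
   the product of the hyperbolic derivatives along the orbit of z. *)
Lemma not_merging_hyp_derive (f : C -> C) (z w : C) (d : R) :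
  disc_map f -> Cmod z < 1 -> Cmod w < 1 -> 0 < d ->
  (forall n, d <= pd (Nat.iter n f w) (Nat.iter n f z)) ->
  exists N, forall m, / 2 <= hyp_derive (Nat.iter m f) (Nat.iter N f z).
Proof.
  intros Hf Hz Hw Hd Hs.
  set (s := fun n => pd (Nat.iter n f w) (Nat.iter n f z)).
  assert (Hdec : forall n, s (S n) <= s n) by (intros n; apply pd_iter_decr; auto; lia).
  destruct (ex_finite_lim_seq_decr s d Hdec Hs) as [l Hl].
  assert (Hls : forall n, l <= s n) by (intros n; now apply is_lim_seq_decr_compare).
  assert (Hs0 : forall n, s n <= s 0%nat) by (intros n; apply pd_iter_decr; auto; lia).
  assert (S0 : s 0%nat < 1) by now apply pd_lt_1.
  assert (S0' : 0 <= s 0%nat) by apply pd_ge_0.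
  (* The gap estimate gives 1 - H <= (1 - y)(1 + s 0) / (1 - s 0) for the hyperbolic derivative H,
     and 1 - y = (s n - s (S n)) / s n has denominator at least d. *)
  set (K := (1 + s 0%nat) / (1 - s 0%nat) / d).
  assert (HK : 0 < K) by (unfold K; repeat apply Rdiv_lt_0_compat; lra).
  apply is_lim_seq_spec in Hl.
  (* From rank N on, the total drop of s is below 1 / (2 * K), so the defects 1 - H sum to at most
     1/2. *)
  destruct (Hl (mkposreal (/ (2 * K)) ltac:(apply Rinv_0_lt_compat; lra))) as [N HN].
  simpl in HN. exists N.
  assert (Hstep : forall n, 1 - hyp_derive f (Nat.iter n f z) <= K * (s n - s (S n))).
  { intros n. pose proof (disc_map_iter_lt_1 f n z Hf Hz) as Zn.
    pose proof (disc_map_iter_lt_1 f n w Hf Hw) as Wn. specialize (Hs n). specialize (Hs0 n).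
    destruct (two_point_schwarz_pick f _ _ Hf Zn Wn) as [y [Hy [E G]]].
    { intros h. rewrite h, pd_refl in Hs. lra. }
    change (s (S n) = y * s n) in E. fold (s n) in Hs, G.
    pose proof (hyp_derive_range f _ Hf Zn) as HH.
    set (H := hyp_derive f (Nat.iter n f z)) in *.
    apply Rabs_le_between in G.
    assert (G2 : (1 - H) * (1 - s n) <= (1 - y) * (1 + s n)).
    { assert (0 <= s n * ((1 - y) * (1 - H))).
      { repeat apply Rmult_le_pos; lra. }
      lra. }
    assert (G3 : (1 - H) * (1 - s 0%nat) <= (1 - y) * (1 + s 0%nat)).
    { apply Rle_trans with ((1 - H) * (1 - s n)); [apply Rmult_le_compat_l; lra|].
      eapply Rle_trans; [exact G2|]. apply Rmult_le_compat_l; lra. }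
    rewrite E. unfold K.
    apply Rmult_le_reg_r with (1 - s 0%nat); [lra|].
    eapply Rle_trans; [exact G3|].
    replace ((1 + s 0%nat) / (1 - s 0%nat) / d * (s n - y * s n) * (1 - s 0%nat))
      with ((1 - y) * (1 + s 0%nat) * (s n / d)) by (field; lra).
    rewrite <- (Rmult_1_r ((1 - y) * (1 + s 0%nat))) at 1.
    apply Rmult_le_compat_l; [apply Rmult_le_pos; lra|].
    apply Rmult_le_reg_r with d; [exact Hd|]. unfold Rdiv. rewrite Rmult_assoc, Rinv_l; lra. }
  assert (Hx : forall m, K * (s N - s (m + N)%nat) <= / 2).
  { intros m. specialize (HN N ltac:(lia)). specialize (Hls (m + N)%nat).
    apply Rabs_lt_between in HN.
    apply Rle_trans with (K * / (2 * K)); [apply Rmult_le_compat_l; lra|].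
    right. field. lra. }
  (* Weierstrass product inequality: a product of factors 1 - e_k is at least 1 minus the sum of the
     e_k, which telescopes here. *)
  assert (Hprod : forall m, 1 - K * (s N - s (m + N)%nat) <=
                            hyp_derive (Nat.iter m f) (Nat.iter N f z)).
  { intros m. induction m as [|m IH].
    - change (Nat.iter 0 f) with (fun w : C => w).
      rewrite (hyp_derive_id (Nat.iter N f z)) by now apply disc_map_iter_lt_1.
      simpl. right. ring.
    - pose proof (disc_map_iter_lt_1 f N z Hf Hz) as ZN.
      change (Nat.iter (S m) f) with (fun w => f (Nat.iter m f w)).
      rewrite (hyp_derive_comp (Nat.iter m f) f) by (auto; now apply disc_map_iter).
      rewrite <- Nat.iter_add. specialize (Hstep (m + N)%nat).
      specialize (Hdec (m + N)%nat). specialize (Hx m).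
      pose proof (hyp_derive_range f _ Hf (disc_map_iter_lt_1 f (m + N) z Hf Hz)) as HH.
      set (H := hyp_derive f (Nat.iter (m + N) f z)) in *.
      set (P := hyp_derive (Nat.iter m f) (Nat.iter N f z)) in *.
      change (S m + N)%nat with (S (m + N)).
      set (x := K * (s N - s (m + N)%nat)) in *.
      set (e := K * (s (m + N)%nat - s (S (m + N)))) in *.
      replace (K * (s N - s (S (m + N)))) with (x + e) by (unfold x, e; ring).
      assert (x0 : 0 <= x).
      { unfold x. apply Rmult_le_pos; [lra|].
        pose proof (pd_iter_decr f (m + N) N w z Hf Hw Hz ltac:(lia)). unfold s. lra. }
      assert (e0 : 0 <= e) by (unfold e; apply Rmult_le_pos; lra).
      nra. }
  intros m. specialize (Hx m). specialize (Hprod m). lra.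
Qed.

Lemma merging_eventually_eq (f : C -> C) (z w : C) (c : R) :
  disc_map f -> Cmod z < 1 -> Cmod w < 1 -> 0 < c ->
  (forall n, c <= hyp_derive (Nat.iter n f) z) -> merging f w z ->
  exists N, Nat.iter N f w = Nat.iter N f z.
Proof.
  intros Hf Hz Hw Hc Hh Hm. destruct (Hm (c / 2) ltac:(lra)) as [N HN]. exists N.
  apply NNPP. intros Hne.
  pose proof (disc_map_iter_lt_1 f N z Hf Hz) as ZN. pose proof (disc_map_iter_lt_1 f N w Hf Hw) as WN.
  set (kap := c / 2 * pd (Nat.iter N f w) (Nat.iter N f z)).
  assert (Hkap : 0 < kap).
  { apply Rmult_lt_0_compat; [lra|]. now apply pd_pos. }
  destruct (Hm kap Hkap) as [m Hm'].
  (* In the chain rule for f^(m+N) at z the other factor is at most 1. *)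
  assert (Hcm : c <= hyp_derive (Nat.iter m f) (Nat.iter N f z)).
  { specialize (Hh (m + N)%nat). rewrite hyp_derive_iter_add in Hh by assumption.
    pose proof (hyp_derive_range _ z (disc_map_iter f N Hf) Hz).
    pose proof (hyp_derive_range _ _ (disc_map_iter f m Hf) ZN). nra. }
  pose proof (pd_expand _ _ _ c (disc_map_iter f m Hf) ZN WN Hne Hcm ltac:(lra)) as G.
  rewrite <- !Nat.iter_add in G. fold kap in G.
  (* The distance is below kap at rank m, hence at rank m + N, where [pd_expand] keeps it at least
     kap. *)
  pose proof (pd_iter_decr f (m + N) m w z Hf Hw Hz ltac:(lia)). lra.
Qed.

(** Otherwise the orbits of f z and z would meet, and f^N (f z) = f^N z makes f^N z a fixed
    point. *)
Lemma zero_step_hyp_derive_vanishes (f : C -> C) (z : C) :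
  disc_map f -> non_elliptic f -> Cmod z < 1 -> merging f (f z) z -> hyp_derive_vanishes f z.
Proof.
  intros Hf Hne Hz Hm. apply NNPP. intros H.
  destruct (not_hyp_derive_vanishes f z H) as [c [Hc Hh]].
  destruct (merging_eventually_eq f z (f z) c Hf Hz (proj1 Hf z Hz) Hc Hh Hm) as [N HN].
  apply Hne. exists (Nat.iter N f z). split; [now apply disc_map_iter_lt_1|].
  rewrite <- Nat.iter_succ, Nat.iter_succ_r. exact HN.
Qed.

(** A tail of the orbit of z has zero step again, so hyperbolic derivatives vanish along it; two
    orbits that stay apart would keep them above 1/2 along some tail. *)
Lemma zero_step_merging (f : C -> C) (z w : C) :
  disc_map f -> non_elliptic f -> Cmod z < 1 -> Cmod w < 1 -> merging f (f z) z -> merging f w z.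
Proof.
  intros Hf Hne Hz Hw Hm. apply NNPP. intros H.
  destruct (not_merging f w z H) as [d [Hd Hs]].
  destruct (not_merging_hyp_derive f z w d Hf Hz Hw Hd Hs) as [N HN].
  pose proof (disc_map_iter_lt_1 f N z Hf Hz) as ZN.
  destruct (zero_step_hyp_derive_vanishes f (Nat.iter N f z) Hf Hne ZN) with (eps := / 2) as [m Hm'].
  - apply (merging_tail f (f z) z N) in Hm; auto; [|now apply Hf].
    rewrite <- Nat.iter_succ_r in Hm. exact Hm.
  - lra.
  - specialize (HN m). lra.
Qed.

(** Both orbits merge. If the derivatives at w stayed away from 0, the orbits would meet, so w would
    inherit the zero step from z and its derivatives would vanish after all. *)
Lemma zero_step_all_hyp_derive_vanish (f : C -> C) (z w : C) :
  disc_map f -> non_elliptic f -> Cmod z < 1 -> Cmod w < 1 -> merging f (f z) z ->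
  hyp_derive_vanishes f w.
Proof.
  intros Hf Hne Hz Hw Hm. apply NNPP. intros H.
  destruct (not_hyp_derive_vanishes f w H) as [c [Hc Hh]].
  pose proof (zero_step_merging f z w Hf Hne Hz Hw Hm) as Hwz.
  apply merging_sym in Hwz; auto.
  destruct (merging_eventually_eq f w z c Hf Hw Hz Hc Hh Hwz) as [N HN].
  apply H. apply zero_step_hyp_derive_vanishes; auto.
  apply (merging_tail f (f w) w N); auto; [now apply Hf|].
  rewrite <- Nat.iter_succ_r. simpl. rewrite <- HN.
  apply (merging_tail f (f z) z N) in Hm; auto; [|now apply Hf].
  rewrite <- Nat.iter_succ_r in Hm. exact Hm.
Qed.

(** Orbits that stay apart bound the derivatives below from the point f^N z on. Multiplying by the
    derivative of f^N at z brings the bound back to z, and it stays positive because the orbit is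
    noncritical. *)
Lemma hyp_derive_vanishes_zero_step (f : C -> C) (z : C) :
  disc_map f -> Cmod z < 1 -> (forall n, 0 < hyp_derive (Nat.iter n f) z) ->
  hyp_derive_vanishes f z -> merging f (f z) z.
Proof.
  intros Hf Hz Hpos Hv. apply NNPP. intros H.
  destruct (not_merging f (f z) z H) as [d [Hd Hs]].
  destruct (not_merging_hyp_derive f z (f z) d Hf Hz (proj1 Hf z Hz) Hd Hs) as [N HN].
  specialize (Hpos N).
  destruct (Hv (/ 2 * hyp_derive (Nat.iter N f) z) ltac:(lra)) as [m Hm].
  pose proof (hyp_derive_iter_decr f (m + N) m z Hf Hz ltac:(lia)) as G.
  rewrite hyp_derive_iter_add in G by assumption. specialize (HN m). nra.
Qed.

(** * Orbits avoiding the critical points *)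

(** Since g a = 0, the hyperbolic quotient is g divided by the Blaschke factor at a. It is again
    bounded by 1 and zero on the ball, in particular differentiable at a, so the division can be
    repeated; g is quantified after n for this induction. *)
Lemma zero_on_ball_pow_bound (a : C) (rho : R) (n : nat) :
  Cmod a < 1 -> 0 < rho -> rho <= 1 - Cmod a ->
  forall g : C -> C, (forall z, Cmod z < 1 -> diff_at g z) ->
    (forall z, Cmod z < 1 -> Cmod (g z) <= 1) ->
    (forall z, Cmod (z - a) < rho -> g z = 0) ->
    forall z, Cmod z < 1 -> Cmod (g z) <= pd z a ^ n.
Proof.
  intros Ha Hrho Hrho1. induction n as [|n IH]; intros g Dg Hg H0 z Hz; [now apply Hg|].
  assert (Haa : Cmod (a - a) < rho).
  { replace (a - a)%C with (RtoC 0) by ring. now rewrite Cmod_0. }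
  assert (Ga : g a = 0) by now apply H0.
  assert (Hk : exists k, diff_quot g a k).
  { apply Dg. exact Ha. }
  destruct Hk as [k Hk].
  assert (Gn : near_holo g) by now apply holo_near_holo.
  assert (Ga1 : Cmod (g a) < 1) by (rewrite Ga, Cmod_0; lra).
  assert (k0 : forall w, Cmod (w - a) < rho -> w <> a -> k w = 0).
  { intros w Hw Hwa. destruct Hk as [_ E]. specialize (E w). rewrite Ga, (H0 w Hw) in E.
    apply NNPP. intros h. pose proof (Cmod_minus_pos w a Hwa) as P. apply Cmod_gt_0 in P.
    apply (Cmult_neq_0 _ _ h P). rewrite <- E. ring. }
  assert (ka : k a = 0).
  { apply Cmod_eq_0. apply Rle_antisym; [|apply Cmod_ge_0].
    apply (cont_at_le_limit (fun z => RtoC (Cmod (k z))) a rho Hrho).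
    - apply cont_at_Cmod, Hk.
    - intros c Hc Hc'. rewrite k0 by assumption. rewrite Cmod_0. simpl. lra. }
  set (q := hyp_quot g k a).
  assert (q0 : forall w, Cmod (w - a) < rho -> q w = 0).
  { intros w Hw. unfold q, hyp_quot.
    destruct (excluded_middle_informative (w = a)) as [->|h];
      [rewrite ka | rewrite (k0 w Hw h)]; unfold Cdiv; ring. }
  assert (Hq : Cmod (q z) <= pd z a ^ n).
  { apply IH; auto.
    - intros w Hw. destruct (excluded_middle_informative (w = a)) as [->|h].
      + apply diff_at_ext_loc with (f := fun _ => RtoC 0) (r := rho);
          [exact Hrho | | apply diff_at_const].
        intros v Hv. symmetry. now apply q0.
      + apply hyp_quot_diff; auto.
    - apply hyp_quot_le_1; auto. }
  pose proof (hyp_quot_spec g k a Hg Ga1 Hk z Hz) as S. fold q in S.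
  destruct (pd_spec z a Hz Ha) as [P E].
  rewrite Ga in S.
  replace (1 - Cconj 0 * g z)%C with (RtoC 1) in S by (apply injective_projections; simpl; ring).
  replace (g z - 0)%C with (g z) in S by ring. rewrite Cmod_1, Rmult_1_l, <- E in S.
  assert (G : Cmod (g z) = Cmod (q z) * pd z a).
  { apply Rmult_eq_reg_r with (Cmod (1 - Cconj a * z)); lra. }
  rewrite G. simpl. rewrite Rmult_comm.
  apply Rmult_le_compat_l; [apply pd_ge_0 | exact Hq].
Qed.

Lemma disc_map_const_on_ball (f : C -> C) (a : C) (rho : R) :
  disc_map f -> Cmod a < 1 -> 0 < rho -> rho <= 1 - Cmod a ->
  (forall z, Cmod (z - a) < rho -> f z = f a) ->
  forall z, Cmod z < 1 -> f z = f a.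
Proof.
  intros [H1 H2] Ha Hrho Hrho1 H z Hz.
  (* The factor 1/2 brings the difference of two points of the disc below modulus 1. *)
  set (g := fun z => (RtoC (/ 2) * (f z - f a))%C).
  assert (B : forall n, Cmod (g z) <= pd z a ^ n).
  { intros n. apply (zero_on_ball_pow_bound a rho n Ha Hrho Hrho1); auto.
    - intros w Hw. apply diff_at_mult; [apply diff_at_const|].
      apply diff_at_minus; [now apply H2 | apply diff_at_const].
    - intros w Hw. unfold g. rewrite Cmod_mult, Cmod_R, Rabs_pos_eq by lra.
      pose proof (Cmod_triangle (f w) (- f a)) as T. rewrite Cmod_opp in T.
      change (f w + - f a)%C with (f w - f a)%C in T.
      pose proof (H1 w Hw). pose proof (H1 a Ha). lra.
    - intros w Hw. unfold g. rewrite (H w Hw). ring. }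
  apply Cminus_0_eq. apply NNPP. intros h.
  assert (P : 0 < Cmod (g z)).
  { unfold g. rewrite Cmod_mult, Cmod_R, Rabs_pos_eq by lra.
    pose proof (Cmod_ge_0 (f z - f a)). lra. }
  destruct (pow_lt_1_zero (pd z a)) with (y := Cmod (g z)) as [N HN];
    [rewrite Rabs_pos_eq by apply pd_ge_0; now apply pd_lt_1 | exact P |].
  specialize (HN N ltac:(lia)). specialize (B N).
  rewrite Rabs_pos_eq in HN by (apply pow_le, pd_ge_0). lra.
Qed.

(** Along the segment from a to z, the real function Re(c f) with c = conj(f z - f a) has zero
    derivative, and its total increment is |f z - f a|^2. *)
Lemma zero_derive_const_on_ball (f : C -> C) (a : C) (rho : R) :
  (forall z, Cmod (z - a) < rho -> diff_at f z /\ C_derive f z = 0) ->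
  forall z, Cmod (z - a) < rho -> f z = f a.
Proof.
  intros H z Hz.
  set (c := Cconj (f z - f a)). set (h := (z - a)%C).
  set (g := fun t : R => Re (c * f (a + RtoC t * h))%C).
  assert (D : forall t, 0 <= t <= 1 -> is_derive g t 0).
  { intros t Ht.
    set (p := (a + RtoC t * h)%C).
    assert (Hp : Cmod (p - a) < rho).
    { unfold p. replace (a + RtoC t * h - a)%C with (RtoC t * h)%C by ring.
      rewrite Cmod_mult, Cmod_R, Rabs_pos_eq by lra. pose proof (Cmod_ge_0 h).
      unfold h in *. nra. }
    destruct (H p Hp) as [[k Hk] Hd]. rewrite (diff_quot_C_derive f k p Hk) in Hd.
    destruct Hk as [Ck E]. apply is_derive_Reals. intros eps He.
    pose proof (Cmod_ge_0 c). pose proof (Cmod_ge_0 h).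
    set (M := Cmod c * Cmod h + 1). assert (HM : 0 < M) by (unfold M; nra).
    destruct (Ck (eps / M)) as [eta [Heta HC]]; [now apply Rdiv_lt_0_compat|].
    assert (Hd' : 0 < eta / (Cmod h + 1)) by (apply Rdiv_lt_0_compat; lra).
    exists (mkposreal _ Hd'). intros s Hs Hs'. simpl in Hs'. rewrite Rminus_0_r.
    assert (Es : (a + RtoC (t + s) * h = p + RtoC s * h)%C).
    { unfold p. rewrite RtoC_plus. ring. }
    assert (Hsh : Cmod (RtoC s * h)%C < eta).
    { rewrite Cmod_mult, Cmod_R.
      apply Rle_lt_trans with (Rabs s * (Cmod h + 1)).
      - apply Rmult_le_compat_l; [apply Rabs_pos | lra].
      - apply Rmult_lt_reg_r with (/ (Cmod h + 1)); [apply Rinv_0_lt_compat; lra|].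
        rewrite Rmult_assoc, Rinv_r by lra. rewrite Rmult_1_r. exact Hs'. }
    specialize (HC (p + RtoC s * h)%C). specialize (E (p + RtoC s * h)%C).
    replace (p + RtoC s * h - p)%C with (RtoC s * h)%C in HC, E by ring.
    specialize (HC Hsh). rewrite Hd in HC.
    replace (k (p + RtoC s * h) - 0)%C with (k (p + RtoC s * h))%C in HC by ring.
    unfold Rdiv. rewrite Rabs_mult, Rabs_inv.
    apply Rmult_lt_reg_r with (Rabs s); [now apply Rabs_pos_lt|].
    rewrite Rmult_assoc, Rinv_l by now apply Rabs_no_R0. rewrite Rmult_1_r.
    unfold g. rewrite Es. fold p.
    eapply Rle_lt_trans; [apply Re_minus_le|].
    replace (c * f (p + RtoC s * h) - c * f p)%C with (c * (f (p + RtoC s * h) - f p))%C by ring.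
    rewrite E, !Cmod_mult, Cmod_R.
    set (K := Cmod (k (p + RtoC s * h)%C)) in *.
    assert (K0 : 0 <= K) by apply Cmod_ge_0.
    replace (Cmod c * (K * (Rabs s * Cmod h))) with (K * (Cmod c * Cmod h) * Rabs s) by ring.
    apply Rmult_lt_compat_r; [now apply Rabs_pos_lt|].
    apply Rle_lt_trans with (K * M); [apply Rmult_le_compat_l; unfold M; lra|].
    apply Rmult_lt_reg_r with (/ M); [now apply Rinv_0_lt_compat|].
    rewrite Rmult_assoc, Rinv_r by lra. rewrite Rmult_1_r. exact HC. }
  pose proof (eq_is_derive (V := R_NormedModule) g 0 1 D Rlt_0_1) as G.
  unfold g in G.
  replace (a + RtoC 0 * h)%C with a in G by (unfold h; ring).
  replace (a + RtoC 1 * h)%C with z in G by (unfold h; ring).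
  apply Cminus_0_eq. apply Rsqr_0_uniq. rewrite Rsqr_pow2, Cmod2.
  unfold c in G. destruct (f z), (f a). simpl in *. lra.
Qed.

(** If f^n had zero derivative on the ball, it would be constant there, hence on the disc, and its
    value would be a fixed point: f (f^n a) = f^n (f a) = f^n a. *)
Lemma iter_hyp_derive_pos_near (f : C -> C) (n : nat) (a : C) (rho : R) :
  disc_map f -> non_elliptic f -> Cmod a < 1 -> 0 < rho -> rho <= 1 - Cmod a ->
  exists z, Cmod (z - a) < rho /\ 0 < hyp_derive (Nat.iter n f) z.
Proof.
  intros Hf Hne Ha Hrho Hrho1. apply NNPP. intros Hno.
  pose proof (disc_map_iter f n Hf) as Hn.
  assert (B : forall z, Cmod (z - a) < rho -> Cmod z < 1).
  { intros z Hz. pose proof (Cmod_triangle_rev z a). lra. }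
  assert (Z : forall z, Cmod (z - a) < rho -> Nat.iter n f z = Nat.iter n f a).
  { apply zero_derive_const_on_ball. intros z Hz. split; [now apply Hn, B|].
    apply NNPP. intros h. apply Hno. exists z. split; [exact Hz|].
    apply Cmod_gt_0 in h. pose proof (one_minus_sq_pos z (B z Hz)).
    pose proof (one_minus_sq_pos _ (proj1 Hn z (B z Hz))).
    apply Rdiv_lt_0_compat; [|assumption]. now apply Rmult_lt_0_compat. }
  pose proof (disc_map_const_on_ball _ a rho Hn Ha Hrho Hrho1 Z) as K.
  apply Hne. exists (Nat.iter n f a). split; [now apply Hn|].
  rewrite <- Nat.iter_succ, Nat.iter_succ_r. apply K. now apply Hf.
Qed.

Lemma noncritical_orbit (f : C -> C) :
  disc_map f -> non_elliptic f ->
  exists z, Cmod z < 1 /\ forall n, 0 < hyp_derive (Nat.iter n f) z.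
Proof.
  intros Hf Hne.
  set (good := fun p : C * R => 0 < snd p /\ Cmod (fst p) + snd p <= 1).
  assert (Step : forall n (P : {p | good p}), exists Q : {p | good p},
    (forall z, Cmod (z - fst (proj1_sig Q)) <= snd (proj1_sig Q) ->
       Cmod (z - fst (proj1_sig P)) <= snd (proj1_sig P) /\ Cmod z < 1 /\
       0 < hyp_derive (Nat.iter n f) z)).
  { intros n [[a rho] [Hrho Ha]]. simpl in *.
    destruct (iter_hyp_derive_pos_near f n a rho Hf Hne) as [b [Hb Hpos]]; try lra.
    pose proof (Cmod_triangle_rev b a) as T.
    set (H := hyp_derive (Nat.iter n f) b) in *.
    (* The first term nests the closed balls; the second gives pd z b <= H / 4 on the new ball, so
       the Lipschitz estimate leaves a derivative of at least H / 2. *)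
    set (r := Rmin ((rho - Cmod (b - a)) / 2) (H * (1 - Cmod b) / 4)).
    assert (Hr : 0 < r).
    { apply Rmin_pos; [lra|]. apply Rdiv_lt_0_compat; [apply Rmult_lt_0_compat; lra | lra]. }
    pose proof (Rmin_l ((rho - Cmod (b - a)) / 2) (H * (1 - Cmod b) / 4)) as R1.
    pose proof (Rmin_r ((rho - Cmod (b - a)) / 2) (H * (1 - Cmod b) / 4)) as R2. fold r in R1, R2.
    assert (G : good (b, r)) by (split; simpl; lra).
    exists (exist _ (b, r) G). simpl. intros z Hz.
    pose proof (Cmod_minus_triangle z b a). pose proof (Cmod_triangle_rev z b).
    assert (Z1 : Cmod z < 1) by lra. assert (B1 : Cmod b < 1) by lra.
    repeat split; [lra | exact Z1 |].
    pose proof (hyp_derive_lipschitz (Nat.iter n f) b z (disc_map_iter f n Hf) B1 Z1) as L.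
    fold H in L. destruct (pd_spec z b Z1 B1) as [_ E].
    pose proof (Cmod_den_ge z b). pose proof (pd_ge_0 z b). pose proof (Cmod_ge_0 b).
    pose proof (Cmod_ge_0 z).
    assert (D : 1 - Cmod b <= Cmod (1 - Cconj b * z)) by nra.
    assert (P : pd z b <= H / 4).
    { apply Rmult_le_reg_r with (1 - Cmod b); [lra|].
      apply Rle_trans with (pd z b * Cmod (1 - Cconj b * z)); [now apply Rmult_le_compat_l | lra]. }
    lra. }
  assert (G0 : good (RtoC 0, / 2)) by (split; simpl; [|rewrite Cmod_0]; lra).
  pose (step := fun n P => proj1_sig (constructive_indefinite_description _ (Step n P))).
  pose (ball := nat_rect (fun _ => {p | good p}) (exist _ _ G0) step).
  assert (Hstep : forall n z, Cmod (z - fst (proj1_sig (ball (S n)))) <= snd (proj1_sig (ball (S n))) ->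
       Cmod (z - fst (proj1_sig (ball n))) <= snd (proj1_sig (ball n)) /\ Cmod z < 1 /\
       0 < hyp_derive (Nat.iter n f) z).
  { intros n. exact (proj2_sig (constructive_indefinite_description _ (Step n (ball n)))). }
  assert (Hnest : forall n m z, (n <= m)%nat ->
     Cmod (z - fst (proj1_sig (ball m))) <= snd (proj1_sig (ball m)) ->
     Cmod (z - fst (proj1_sig (ball n))) <= snd (proj1_sig (ball n))).
  { intros n m z Hnm. induction Hnm as [|m Hnm IH]; [auto|]. intros h. apply IH. now apply Hstep. }
  set (u := fun n => fst (proj1_sig (ball n))).
  assert (Hu : forall n m, (n <= m)%nat -> Cmod (u m - u n) <= snd (proj1_sig (ball n))).
  { intros n m Hnm. apply (Hnest n m _ Hnm).
    unfold u. replace (fst (proj1_sig (ball m)) - fst (proj1_sig (ball m)))%C with (RtoC 0) by ring.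
    rewrite Cmod_0. left. apply (proj2_sig (ball m)). }
  destruct (C_bounded_cluster u 1) as [z Hz].
  { intros n. destruct (proj2_sig (ball n)) as [h1 h2]. unfold u. lra. }
  assert (Hzn : forall n, Cmod (z - u n) <= snd (proj1_sig (ball n))).
  { intros n. apply Rnot_lt_le. intros h.
    destruct (Hz (Cmod (z - u n) - snd (proj1_sig (ball n))) ltac:(lra) n) as [m [Hm Hm']].
    specialize (Hu n m Hm). pose proof (Cmod_minus_triangle z (u m) (u n)).
    rewrite Cmod_minus_sym in Hm'. lra. }
  (* The ball of index n + 1 is the one that controls the n-th iterate. *)
  exists z. split; [apply (Hstep 0%nat z (Hzn 1%nat)) | intros n; apply (Hstep n z (Hzn (S n)))].
Qed.

(** * Zero step implies parabolic *)

Lemma Cmod_minus_le_pd (z w : C) : Cmod z < 1 -> Cmod w < 1 -> Cmod (z - w) <= 2 * pd z w.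
Proof.
  intros Hz Hw. destruct (pd_spec z w Hz Hw) as [_ E]. rewrite <- E.
  pose proof (Cmod_triangle 1 (- (Cconj w * z))) as T.
  rewrite Cmod_opp, Cmod_mult, Cmod_conj, Cmod_1 in T.
  change (1 + - (Cconj w * z))%C with (1 - Cconj w * z)%C in T.
  pose proof (Cmod_ge_0 z). pose proof (Cmod_ge_0 w). pose proof (pd_ge_0 z w).
  rewrite Rmult_comm. apply Rmult_le_compat_r; nra.
Qed.

(** Hyperbolically close points have comparable distances to the circle: along a zero-step orbit (1
    - |f z|^2) / (1 - |z|^2) has upper limit at most 1. *)
Lemma one_minus_sq_ratio (z w : C) : Cmod z < 1 -> Cmod w < 1 ->
  (1 - Cmod w ^ 2) * (1 - pd z w) <= (1 - Cmod z ^ 2) * (1 + pd z w) ^ 2.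
Proof.
  intros Hz Hw. pose proof (pd_Cmod z w Hz Hw) as P. pose proof (pd_ge_0 z w) as E0.
  pose proof (pd_lt_1 z w Hz Hw). pose proof (Cmod_ge_0 z). pose proof (Cmod_ge_0 w).
  set (x := Cmod z) in *. set (y := Cmod w) in *. set (e := pd z w) in *.
  apply Rabs_le_between in P.
  assert (A : (1 - y) * (1 - e) <= (1 - x) * (1 + e)).
  { assert (0 <= e * ((1 - x) * (1 - y))) by (apply Rmult_le_pos; [lra | nra]). nra. }
  assert (B : 1 + y <= (1 + x) * (1 + e)).
  { assert (0 <= e * (x * y)) by (apply Rmult_le_pos; [lra | nra]). nra. }
  replace ((1 - y ^ 2) * (1 - e)) with ((1 - y) * (1 - e) * (1 + y)) by ring.
  replace ((1 - x ^ 2) * (1 + e) ^ 2) with ((1 - x) * (1 + e) * ((1 + x) * (1 + e))) by ring.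
  apply Rmult_le_compat; [apply Rmult_le_pos; lra | lra | exact A | exact B].
Qed.

Definition zero_step (f : C -> C) (b : C) : Prop := Cmod b < 1 /\ merging f (f b) b.

Lemma zero_step_small (f : C -> C) (b : C) : disc_map f -> zero_step f b ->
  forall eps, 0 < eps -> exists N, forall n, (N <= n)%nat ->
    pd (f (Nat.iter n f b)) (Nat.iter n f b) < eps.
Proof.
  intros Hf [Hb Hm] eps He. destruct (Hm eps He) as [N HN]. exists N. intros n Hn.
  rewrite <- Nat.iter_succ, Nat.iter_succ_r.
  eapply Rle_lt_trans; [|exact HN]. apply pd_iter_decr; auto. now apply Hf.
Qed.

(** A cluster point p inside the disc would satisfy f p = p, since the steps of the orbit tend to 0
    and f is continuous at p. *)
Lemma zero_step_orbit_to_boundary (f : C -> C) (b : C) :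
  disc_map f -> non_elliptic f -> zero_step f b ->
  forall eta, 0 < eta -> exists N, forall n, (N <= n)%nat -> 1 - eta < Cmod (Nat.iter n f b).
Proof.
  intros Hf Hne Hs eta Heta. apply NNPP. intros Hno.
  assert (Sub : forall N, exists n, (N <= n)%nat /\ Cmod (Nat.iter n f b) <= 1 - eta).
  { intros N. apply NNPP. intros h. apply Hno. exists N. intros n Hn.
    apply Rnot_le_lt. intros h'. apply h. now exists n. }
  pose (sub := fun N => proj1_sig (constructive_indefinite_description _ (Sub N))).
  assert (Hsub : forall N, (N <= sub N)%nat /\ Cmod (Nat.iter (sub N) f b) <= 1 - eta).
  { intros N. exact (proj2_sig (constructive_indefinite_description _ (Sub N))). }
  destruct (C_bounded_cluster (fun N => Nat.iter (sub N) f b) (1 - eta)) as [p Hp].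
  { intros N. apply Hsub. }
  assert (P1 : Cmod p < 1).
  { destruct (Hp eta Heta 0%nat) as [n [_ Hn]]. destruct (Hsub n) as [_ h].
    pose proof (Cmod_triangle_rev p (Nat.iter (sub n) f b)). rewrite Cmod_minus_sym in Hn. lra. }
  apply Hne. exists p. split; [exact P1|]. apply Cminus_0_eq.
  apply Rle_antisym; [|apply Cmod_ge_0].
  (* The path from f p through f u and u to p costs eps + 2 * eps + eps, less than five. *)
  apply Rnot_lt_le. intros h. set (eps := Cmod (f p - p) / 5). assert (He : 0 < eps) by (unfold eps; lra).
  destruct (diff_at_cont f p (proj2 Hf p P1) eps He) as [d [Hd HC]].
  destruct (zero_step_small f b Hf Hs eps He) as [M HM].
  destruct (Hp (Rmin d eps) ltac:(now apply Rmin_pos) M) as [n [Hn Hn']].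
  destruct (Hsub n) as [Hsn _].
  pose proof (Rmin_l d eps). pose proof (Rmin_r d eps).
  set (u := Nat.iter (sub n) f b) in *.
  assert (U1 : Cmod u < 1) by (apply disc_map_iter_lt_1; [exact Hf | apply Hs]).
  specialize (HC u ltac:(lra)). specialize (HM (sub n) ltac:(lia)). fold u in HM.
  pose proof (Cmod_minus_le_pd (f u) u (proj1 Hf u U1) U1).
  pose proof (Cmod_minus_triangle (f p) (f u) p). pose proof (Cmod_minus_triangle (f u) u p).
  rewrite Cmod_minus_sym in HC. unfold eps in *. lra.
Qed.

(* Reciprocal of the Poisson kernel; its sublevel sets are the horodiscs at tau. *)
Definition horo (tau w : C) : R := Cmod (tau - w) ^ 2 / (1 - Cmod w ^ 2).

Lemma Cmod_den_boundary (tau w : C) : Cmod tau = 1 -> Cmod (1 - Cconj tau * w) = Cmod (tau - w).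
Proof.
  intros Ht. pose proof (Cmod_den_identity tau w) as E. rewrite Ht in E.
  rewrite Cmod_den_sym. apply Rsqr_inj; try apply Cmod_ge_0. rewrite !Rsqr_pow2. lra.
Qed.

Lemma Cmod_den_dist (a b w : C) : Cmod w <= 1 ->
  Cmod (1 - Cconj a * w) <= Cmod (1 - Cconj b * w) + Cmod (a - b).
Proof.
  intros Hw.
  replace (1 - Cconj a * w)%C with ((1 - Cconj b * w) + (Cconj (b - a) * w))%C
    by (rewrite Cminus_conj; ring).
  eapply Rle_trans; [apply Cmod_triangle|]. rewrite Cmod_mult, Cmod_conj, (Cmod_minus_sym b a).
  pose proof (Cmod_ge_0 (a - b)). nra.
Qed.

(** Julia's lemma with constant 1. Schwarz-Pick at an orbit point z compares (1 - |w|^2)(1 - |z|^2)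
    / |1 - conj(z) w|^2 with its image. Along a subsequence z and f z both tend to tau, the
    denominators tend to |tau - w|^2 and |tau - f w|^2, and [one_minus_sq_ratio] removes the factors
    of z and f z. *)
Lemma zero_step_horo_decr (f : C -> C) (b : C) :
  disc_map f -> non_elliptic f -> zero_step f b ->
  exists tau, Cmod tau = 1 /\ forall w, Cmod w < 1 -> horo tau (f w) <= horo tau w.
Proof.
  intros Hf Hne Hs.
  assert (Z1 : forall n, Cmod (Nat.iter n f b) < 1).
  { intros n. apply disc_map_iter_lt_1; [exact Hf | apply Hs]. }
  destruct (C_bounded_cluster (fun n => Nat.iter n f b) 1) as [tau Htau].
  { intros n. left. apply Z1. }
  assert (T1 : Cmod tau = 1).
  { apply Rle_antisym; apply Rnot_lt_le; intros h.
    - destruct (Htau (Cmod tau - 1) ltac:(lra) 0%nat) as [n [_ Hn]]. specialize (Z1 n).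
      pose proof (Cmod_triangle_rev tau (Nat.iter n f b)). rewrite Cmod_minus_sym in Hn. lra.
    - destruct (zero_step_orbit_to_boundary f b Hf Hne Hs ((1 - Cmod tau) / 2) ltac:(lra)) as [N HN].
      destruct (Htau ((1 - Cmod tau) / 2) ltac:(lra) N) as [n [Hn Hn']]. specialize (HN n Hn).
      pose proof (Cmod_triangle_rev (Nat.iter n f b) tau). lra. }
  exists tau. split; [exact T1|]. intros w Hw.
  pose proof (proj1 Hf w Hw) as Hfw.
  pose proof (one_minus_sq_pos w Hw) as Pa. pose proof (one_minus_sq_pos (f w) Hfw) as Pb.
  set (a := 1 - Cmod w ^ 2) in *. set (c := 1 - Cmod (f w) ^ 2) in *.
  set (al := Cmod (tau - f w)). set (be := Cmod (tau - w)).
  assert (A1 : a <= 1) by (unfold a; pose proof (pow2_ge_0 (Cmod w)); lra).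
  assert (C1 : c <= 1) by (unfold c; pose proof (pow2_ge_0 (Cmod (f w))); lra).
  assert (Al : 0 < al <= 2).
  { unfold al. pose proof (Cmod_triangle_rev tau (f w)). pose proof (Cmod_triangle tau (- f w)) as T.
    rewrite Cmod_opp in T. change (tau + - f w)%C with (tau - f w)%C in T. lra. }
  assert (Be : 0 <= be <= 2).
  { unfold be. split; [apply Cmod_ge_0|]. pose proof (Cmod_triangle tau (- w)) as T.
    rewrite Cmod_opp in T. change (tau + - w)%C with (tau - w)%C in T. lra. }
  (* The limit in quantitative form: t measures the distance of z and f z from tau, and 40 = 8 + 32
     collects the errors [L] and [Rr]. *)
  assert (Key : forall t, 0 < t -> t < 1 -> t < al -> a * al ^ 2 <= c * be ^ 2 + 40 * t).
  { intros t Ht Ht1 Hta.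
    (* A step below t / 4 moves z by at most t / 2 in modulus, so z within t / 2 of tau keeps f z
       within t. *)
    destruct (zero_step_small f b Hf Hs (t / 4) ltac:(lra)) as [N HN].
    destruct (Htau (t / 2) ltac:(lra) N) as [n [Hn Hn']]. specialize (HN n Hn).
    set (z := Nat.iter n f b) in *. specialize (Z1 n). fold z in Z1.
    pose proof (proj1 Hf z Z1) as Zf.
    pose proof (Cmod_minus_le_pd (f z) z Zf Z1) as D.
    pose proof (Cmod_minus_triangle (f z) z tau) as T.
    pose proof (pd_contract f z w Hf Z1 Hw) as PC.
    pose proof (pd_identity w z Hw Z1) as I1. pose proof (pd_identity (f w) (f z) Hfw Zf) as I2.
    pose proof (one_minus_sq_ratio z (f z) Z1 Zf) as RT. rewrite (pd_sym z (f z)) in RT by assumption.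
    pose proof (one_minus_sq_pos z Z1) as Pz. pose proof (one_minus_sq_pos (f z) Zf) as Pfz.
    set (e := pd (f z) z) in *. assert (e0 : 0 <= e) by apply pd_ge_0.
    pose proof (Cmod_den_dist z tau w (Rlt_le _ _ Hw)) as B1.
    rewrite (Cmod_den_boundary tau w T1) in B1. fold be in B1.
    pose proof (Cmod_den_dist tau (f z) (f w) (Rlt_le _ _ Hfw)) as B2.
    rewrite (Cmod_den_boundary tau (f w) T1), (Cmod_minus_sym tau (f z)) in B2. fold al in B2.
    fold a in I1. fold c in I2.
    set (X := Cmod (1 - Cconj z * w)) in *. set (Y := Cmod (1 - Cconj (f z) * f w)) in *.
    assert (X0 : 0 <= X) by apply Cmod_ge_0. assert (Y0 : 0 <= Y) by apply Cmod_ge_0.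
    set (p := pd w z) in *. set (q := pd (f w) (f z)) in *.
    assert (q0 : 0 <= q) by apply pd_ge_0.
    set (Z := 1 - Cmod z ^ 2) in *. set (V := 1 - Cmod (f z) ^ 2) in *.
    assert (G1 : a * Z * Y ^ 2 <= c * V * X ^ 2).
    { rewrite <- I1, <- I2.
      replace ((1 - p ^ 2) * X ^ 2 * Y ^ 2) with ((1 - p ^ 2) * (X ^ 2 * Y ^ 2)) by ring.
      replace ((1 - q ^ 2) * Y ^ 2 * X ^ 2) with ((1 - q ^ 2) * (X ^ 2 * Y ^ 2)) by ring.
      apply Rmult_le_compat_r; [apply Rmult_le_pos; apply pow2_ge_0 | nra]. }
    assert (G2 : V * (1 - t) <= Z * (1 + t) ^ 2).
    { apply Rle_trans with (V * (1 - e)); [apply Rmult_le_compat_l; lra|].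
      eapply Rle_trans; [exact RT|]. apply Rmult_le_compat_l; [lra|]. apply pow_incr. lra. }
    assert (G3 : a * Y ^ 2 * (1 - t) <= c * X ^ 2 * (1 + t) ^ 2).
    { apply Rmult_le_reg_l with Z; [exact Pz|].
      apply Rle_trans with (c * V * X ^ 2 * (1 - t)).
      - replace (Z * (a * Y ^ 2 * (1 - t))) with (a * Z * Y ^ 2 * (1 - t)) by ring.
        apply Rmult_le_compat_r; lra.
      - replace (c * V * X ^ 2 * (1 - t)) with (c * X ^ 2 * (V * (1 - t))) by ring.
        replace (Z * (c * X ^ 2 * (1 + t) ^ 2)) with (c * X ^ 2 * (Z * (1 + t) ^ 2)) by ring.
        apply Rmult_le_compat_l; [apply Rmult_le_pos; [lra | apply pow2_ge_0] | exact G2]. }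
    assert (Y1 : (al - t) ^ 2 <= Y ^ 2) by (apply pow_incr; lra).
    assert (X1 : X ^ 2 <= (be + t) ^ 2) by (apply pow_incr; lra).
    assert (t1 : 0 <= t * (1 - t)) by (apply Rmult_le_pos; lra).
    assert (L : al ^ 2 - 8 * t <= Y ^ 2 * (1 - t)).
    { apply Rle_trans with ((al - t) ^ 2 * (1 - t)); [|apply Rmult_le_compat_r; lra].
      assert (t2 : (al - t) ^ 2 <= 2 ^ 2) by (apply pow_incr; lra).
      assert (t3 : t * (al - t) ^ 2 <= t * 2 ^ 2) by (apply Rmult_le_compat_l; lra).
      assert (t4 : 0 <= t * (2 - al)) by (apply Rmult_le_pos; lra).
      pose proof (pow2_ge_0 t). lra. }
    assert (Rr : X ^ 2 * (1 + t) ^ 2 <= be ^ 2 + 32 * t).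
    { assert (t2 : 0 <= t * (2 - be)) by (apply Rmult_le_pos; lra).
      assert (t3 : be ^ 2 <= 2 ^ 2) by (apply pow_incr; lra).
      assert (t4 : t * be ^ 2 <= t * 2 ^ 2) by (apply Rmult_le_compat_l; lra).
      apply Rle_trans with ((be ^ 2 + 5 * t) * (1 + 3 * t)).
      - apply Rmult_le_compat; try apply pow2_ge_0; lra.
      - lra. }
    assert (F1 : a * (al ^ 2 - 8 * t) <= a * (Y ^ 2 * (1 - t))) by (apply Rmult_le_compat_l; lra).
    assert (F2 : c * (X ^ 2 * (1 + t) ^ 2) <= c * (be ^ 2 + 32 * t)) by (apply Rmult_le_compat_l; lra).
    assert (0 <= (1 - a) * t) by (apply Rmult_le_pos; lra).
    assert (0 <= (1 - c) * t) by (apply Rmult_le_pos; lra). lra. }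
  unfold horo. fold a c al be.
  apply Rmult_le_reg_r with (a * c); [now apply Rmult_lt_0_compat|].
  replace (al ^ 2 / c * (a * c)) with (a * al ^ 2) by (field; lra).
  replace (be ^ 2 / a * (a * c)) with (c * be ^ 2) by (field; lra).
  apply Rnot_lt_le. intros h.
  set (t := Rmin (/ 2) (Rmin (al / 2) ((a * al ^ 2 - c * be ^ 2) / 80))).
  pose proof (Rmin_l (/ 2) (Rmin (al / 2) ((a * al ^ 2 - c * be ^ 2) / 80))) as m1.
  pose proof (Rmin_r (/ 2) (Rmin (al / 2) ((a * al ^ 2 - c * be ^ 2) / 80))) as m2.
  pose proof (Rmin_l (al / 2) ((a * al ^ 2 - c * be ^ 2) / 80)).
  pose proof (Rmin_r (al / 2) ((a * al ^ 2 - c * be ^ 2) / 80)). fold t in m1, m2.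
  assert (Ht : 0 < t) by (repeat apply Rmin_pos; lra).
  specialize (Key t Ht ltac:(lra) ltac:(lra)). lra.
Qed.

Lemma horo_iter_decr (f : C -> C) (tau w : C) (n : nat) : disc_map f ->
  (forall w, Cmod w < 1 -> horo tau (f w) <= horo tau w) -> Cmod w < 1 ->
  horo tau (Nat.iter n f w) <= horo tau w.
Proof.
  intros Hf H Hw. induction n as [|n IH]; [simpl; lra|].
  eapply Rle_trans; [apply H; now apply disc_map_iter_lt_1 | exact IH].
Qed.

(** Points w near z stay at bounded hyperbolic distance from the orbit of b, so 1 - |f^n w|^2 is
    dominated by 1 - |f^n b|^2 and tends to 0 uniformly. Invariance of horodiscs then bounds |tau -
    f^n w|^2 by a constant times 1 - |f^n w|^2. *)
Lemma zero_step_denjoy_wolff (f : C -> C) (b tau : C) :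
  disc_map f -> non_elliptic f -> zero_step f b -> Cmod tau = 1 ->
  (forall w, Cmod w < 1 -> horo tau (f w) <= horo tau w) ->
  denjoy_wolff_point f tau.
Proof.
  intros Hf Hne Hs T1 Hh. split; [exact T1|]. intros z Hz. unfold unit_disc in Hz.
  pose proof (Cmod_ge_0 z) as z0.
  exists (fun w => Cmod (w - z) < (1 - Cmod z) / 2). split.
  { apply locally_Cmod. exists ((1 - Cmod z) / 2). split; [lra | auto]. }
  intros eps. destruct Hs as [Hb Hm].
  set (r := (1 + Cmod z) / 2). assert (Hr : 0 <= r < 1) by (unfold r; lra).
  assert (Pr : 0 < 1 - r ^ 2) by nra.
  pose proof (one_minus_sq_pos b Hb) as Pb.
  (* Lower bound for 1 - pd w b ^ 2 when |w| <= r, from [pd_identity] with a denominator of modulus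
     at most 2. *)
  set (kap := (1 - r ^ 2) * (1 - Cmod b ^ 2) / 4).
  assert (Hkap : 0 < kap) by (apply Rdiv_lt_0_compat; [now apply Rmult_lt_0_compat | lra]).
  (* The first factor bounds horo tau w for |w| <= r, the second is the ratio of 1 - |f^n w|^2 to 1
     - |f^n b|^2. *)
  set (K := 4 / (1 - r ^ 2) * (4 / kap)).
  assert (HK : 0 < K) by (apply Rmult_lt_0_compat; apply Rdiv_lt_0_compat; lra).
  pose proof (cond_pos eps) as He.
  assert (Heta : 0 < eps ^ 2 / (2 * K)) by (apply Rdiv_lt_0_compat; [now apply pow_lt | lra]).
  destruct (zero_step_orbit_to_boundary f b Hf Hne (conj Hb Hm) _ Heta) as [N HN].
  exists N. intros n Hn w Hw Hwz. unfold unit_disc in Hw. specialize (HN n Hn).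
  pose proof (Cmod_triangle_rev w z) as Tw.
  assert (Wr : Cmod w <= r) by (unfold r; lra).
  pose proof (Cmod_ge_0 w) as w0.
  pose proof (disc_map_iter_lt_1 f n b Hf Hb) as Bn. pose proof (disc_map_iter_lt_1 f n w Hf Hw) as Wn.
  pose proof (pd_identity w b Hw Hb) as I1. pose proof (pd_identity _ _ Wn Bn) as I2.
  pose proof (pd_contract _ b w (disc_map_iter f n Hf) Hb Hw) as PC.
  pose proof (horo_iter_decr f tau w n Hf Hh Hw) as HH. unfold horo in HH.
  set (wn := Nat.iter n f w) in *. set (bn := Nat.iter n f b) in *.
  pose proof (one_minus_sq_pos wn Wn) as Pwn. pose proof (one_minus_sq_pos bn Bn) as Pbn.
  pose proof (one_minus_sq_pos w Hw) as Pw.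
  pose proof (Cmod_ge_0 wn) as wn0. pose proof (Cmod_ge_0 bn) as bn0. pose proof (Cmod_ge_0 b) as b0.
  assert (Kp : kap <= 1 - pd w b ^ 2).
  { destruct (pd_spec w b Hw Hb) as [P _].
    pose proof (Cmod_triangle 1 (- (Cconj b * w))) as T.
    rewrite Cmod_opp, Cmod_mult, Cmod_conj, Cmod_1 in T.
    change (1 + - (Cconj b * w))%C with (1 - Cconj b * w)%C in T.
    set (X := Cmod (1 - Cconj b * w)) in *.
    assert (X2 : X <= 2) by nra.
    assert (X4 : X ^ 2 <= 4) by nra.
    assert (Q : (1 - r ^ 2) * (1 - Cmod b ^ 2) <= (1 - Cmod w ^ 2) * (1 - Cmod b ^ 2)).
    { apply Rmult_le_compat_r; [lra|]. nra. }
    assert (0 <= 1 - pd w b ^ 2).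
    { pose proof (pd_lt_1 w b Hw Hb). pose proof (pd_ge_0 w b). nra. }
    unfold kap. nra. }
  assert (Kq : kap <= 1 - pd wn bn ^ 2) by (pose proof (pd_ge_0 wn bn); nra).
  assert (Dn : (1 - Cmod wn ^ 2) / 2 <= Cmod (1 - Cconj bn * wn)).
  { pose proof (Cmod_den_ge wn bn). nra. }
  assert (W1 : 1 - Cmod wn ^ 2 <= 4 / kap * (1 - Cmod bn ^ 2)).
  { set (X := Cmod (1 - Cconj bn * wn)) in *. set (A := 1 - Cmod wn ^ 2) in *.
    set (B := 1 - Cmod bn ^ 2) in *.
    assert (S : (A / 2) ^ 2 <= X ^ 2) by (apply pow_incr; lra).
    assert (S2 : kap * (A / 2) ^ 2 <= A * B).
    { rewrite <- I2. apply Rmult_le_compat; [lra | apply pow2_ge_0 | exact Kq | exact S]. }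
    apply Rmult_le_reg_l with (A * (kap / 4)); [apply Rmult_lt_0_compat; lra|].
    replace (A * (kap / 4) * (4 / kap * B)) with (A * B) by (field; lra). lra. }
  assert (T2 : Cmod (tau - w) ^ 2 <= 4).
  { pose proof (Cmod_triangle tau (- w)) as T. rewrite Cmod_opp in T.
    change (tau + - w)%C with (tau - w)%C in T. pose proof (Cmod_ge_0 (tau - w)). nra. }
  assert (HT : Cmod (tau - wn) ^ 2 <= 4 / (1 - r ^ 2) * (1 - Cmod wn ^ 2)).
  { apply Rmult_le_reg_r with (/ (1 - Cmod wn ^ 2)); [now apply Rinv_0_lt_compat|].
    rewrite (Rmult_assoc (4 / _)), Rinv_r, Rmult_1_r by lra.
    eapply Rle_trans; [exact HH|].
    apply Rmult_le_compat; [apply pow2_ge_0 | left; now apply Rinv_0_lt_compat | exact T2 |].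
    apply Rinv_le_contravar; [exact Pr | nra]. }
  assert (Bq : 1 - Cmod bn ^ 2 < eps ^ 2 / K).
  { assert (E : eps ^ 2 / K = 2 * (eps ^ 2 / (2 * K))) by (field; lra). rewrite E. nra. }
  assert (F : Cmod (tau - wn) ^ 2 < eps ^ 2).
  { eapply Rle_lt_trans; [exact HT|].
    apply Rle_lt_trans with (K * (1 - Cmod bn ^ 2)).
    - unfold K. rewrite (Rmult_assoc (4 / (1 - r ^ 2))).
      apply Rmult_le_compat_l; [left; apply Rdiv_lt_0_compat; lra | exact W1].
    - apply Rmult_lt_compat_l with (r := K) in Bq; [|exact HK].
      replace (K * (eps ^ 2 / K)) with (eps ^ 2) in Bq by (field; lra). exact Bq. }
  rewrite Cmod_minus_sym.
  apply Rsqr_incrst_0; [rewrite !Rsqr_pow2; exact F | apply Cmod_ge_0 | lra].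
Qed.

(** The Cayley transform G carries the right half-plane to the disc and psi a to 0, so |G z| <= pd z
    a by Schwarz. Solving for X = psi z - i Im(psi a) gives the bound. It controls the modulus of X,
    not only the real part, as the complex difference quotient requires. *)
Lemma harnack (psi : C -> C) (a z : C) :
  (forall w, Cmod w < 1 -> diff_at psi w) -> (forall w, Cmod w < 1 -> 0 < Re (psi w)) ->
  Cmod a < 1 -> Cmod z < 1 ->
  Cmod (psi z - Ci * RtoC (Im (psi a))) * (1 - pd z a) <= Re (psi a) * (1 + pd z a).
Proof.
  intros Dp Hp Ha Hz. set (b := psi a).
  assert (Nz : forall w, Cmod w < 1 -> (psi w + Cconj b <> 0)%C).
  { intros w Hw h. apply (f_equal Re) in h. pose proof (Hp w Hw) as P. pose proof (Hp a Ha) as Q.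
    fold b in Q. destruct (psi w), b. simpl in *. lra. }
  set (G := fun w => ((psi w - b) / (psi w + Cconj b))%C).
  assert (DG : forall w, Cmod w < 1 -> diff_at G w).
  { intros w Hw. apply diff_at_div.
    - apply diff_at_minus; [auto | apply diff_at_const].
    - apply diff_at_plus; [auto | apply diff_at_const].
    - now apply Nz. }
  assert (G1 : forall w, Cmod w < 1 -> Cmod (G w) <= 1).
  { intros w Hw. unfold G. rewrite Cmod_div by now apply Nz.
    assert (P : 0 < Cmod (psi w + Cconj b)) by now apply Cmod_gt_0, Nz.
    apply Rmult_le_reg_r with (1 := P). unfold Rdiv. rewrite Rmult_assoc, Rinv_l by lra.
    rewrite Rmult_1_r, Rmult_1_l.
    apply Rsqr_incr_0; [|apply Cmod_ge_0..]. rewrite !Rsqr_pow2, !Cmod2.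
    pose proof (Hp w Hw) as P1. pose proof (Hp a Ha) as P2. fold b in P2.
    destruct (psi w), b. simpl in *. nra. }
  assert (Ga : G a = 0) by (unfold G; fold b; unfold Cdiv; ring).
  destruct (DG a Ha) as [k Hk].
  assert (Ga1 : Cmod (G a) < 1) by (rewrite Ga, Cmod_0; lra).
  pose proof (schwarz_pick_mult G k a Ha G1 Ga1 Hk (holo_near_holo G DG) z Hz) as S.
  rewrite Ga in S.
  replace (1 - Cconj 0 * G z)%C with (RtoC 1) in S by (apply injective_projections; simpl; ring).
  replace (G z - 0)%C with (G z) in S by ring. rewrite Cmod_1, Rmult_1_l in S.
  destruct (pd_spec z a Hz Ha) as [P E]. rewrite <- E in S.
  apply Rmult_le_reg_r in S; [|exact P].
  unfold G in S. rewrite Cmod_div in S by now apply Nz.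
  assert (Pz : 0 < Cmod (psi z + Cconj b)) by now apply Cmod_gt_0, Nz.
  apply Rmult_le_compat_r with (r := Cmod (psi z + Cconj b)) in S; [|lra].
  unfold Rdiv in S. rewrite Rmult_assoc, Rinv_l, Rmult_1_r in S by lra.
  set (X := (psi z - Ci * RtoC (Im b))%C).
  assert (E1 : (psi z - b = X - RtoC (Re b))%C).
  { unfold X. destruct (psi z), b. apply injective_projections; simpl; ring. }
  assert (E2 : (psi z + Cconj b = X + RtoC (Re b))%C).
  { unfold X. destruct (psi z), b. apply injective_projections; simpl; ring. }
  rewrite E1, E2 in S.
  pose proof (Hp a Ha) as Pa. fold b in Pa.
  pose proof (Cmod_triangle_rev X (RtoC (Re b))) as T1. pose proof (Cmod_triangle X (RtoC (Re b))) as T2.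
  rewrite Cmod_R, Rabs_pos_eq in T1, T2 by lra.
  pose proof (pd_ge_0 z a). nra.
Qed.

(** The holomorphic function on the disc whose real part is the Poisson kernel at tau. *)
Definition poisson (tau w : C) : C := ((tau + w) / (tau - w))%C.

Lemma boundary_neq (tau w : C) : Cmod tau = 1 -> Cmod w < 1 -> (tau - w <> 0)%C.
Proof.
  intros T Hw h. apply Cmod_gt_0 with (x := (tau - w)%C); [|exact h].
  pose proof (Cmod_triangle_rev tau w). lra.
Qed.

Lemma Re_poisson (tau w : C) : Cmod tau = 1 -> Cmod w < 1 ->
  Re (poisson tau w) = (1 - Cmod w ^ 2) / Cmod (tau - w) ^ 2.
Proof.
  intros T Hw. pose proof (boundary_neq tau w T Hw) as N.
  apply Cmod_gt_0 in N. assert (P : 0 < Cmod (tau - w) ^ 2) by now apply pow_lt.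
  assert (T2 : 1 = Cmod tau ^ 2) by (rewrite T; ring).
  rewrite T2. unfold poisson. rewrite !Cmod2 in *. destruct tau as [s t], w as [x y].
  unfold Re, Cdiv, Cinv, Cmult, Cplus, Cminus, Copp in *. simpl in *. field. lra.
Qed.

Lemma diff_at_poisson (tau w : C) : Cmod tau = 1 -> Cmod w < 1 -> diff_at (poisson tau) w.
Proof.
  intros T Hw. apply diff_at_div; [apply diff_at_plus | apply diff_at_minus | now apply boundary_neq];
    (apply diff_at_const || apply diff_at_id).
Qed.

Lemma Re_poisson_pos (tau w : C) : Cmod tau = 1 -> Cmod w < 1 -> 0 < Re (poisson tau w).
Proof.
  intros T Hw. rewrite Re_poisson by assumption.
  apply Rdiv_lt_0_compat; [now apply one_minus_sq_pos|]. apply pow_lt, Cmod_gt_0. now apply boundary_neq.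
Qed.

Lemma Re_poisson_horo (tau w : C) : Cmod tau = 1 -> Cmod w < 1 -> Re (poisson tau w) = / horo tau w.
Proof.
  intros T Hw. rewrite Re_poisson by assumption. unfold horo.
  pose proof (one_minus_sq_pos w Hw). pose proof (boundary_neq tau w T Hw) as N. apply Cmod_gt_0 in N.
  field. lra.
Qed.

(** In the Stolz region horo tau z <= M |tau - z|, and everywhere horo tau (f z) >= |tau - f z| / 2.
    The bound yields the angular limit of f and one factor in the estimate of its difference
    quotient. *)
Lemma horo_stolz_bound (f : C -> C) (tau z : C) (M : R) :
  disc_map f -> Cmod tau = 1 -> (forall w, Cmod w < 1 -> horo tau (f w) <= horo tau w) ->
  Cmod z < 1 -> 0 < M -> Cmod (tau - z) < M * (1 - Cmod z) ->
  Cmod (tau - f z) <= 2 * M * Cmod (tau - z).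
Proof.
  intros Hf T Hh Hz HM HS. pose proof (proj1 Hf z Hz) as Hfz.
  specialize (Hh z Hz). unfold horo in Hh.
  pose proof (Cmod_triangle_rev tau (f z)) as A. rewrite T in A.
  pose proof (Cmod_triangle_rev tau z) as B. rewrite T in B.
  pose proof (one_minus_sq_pos z Hz) as Pz. pose proof (one_minus_sq_pos (f z) Hfz) as Pf.
  pose proof (Cmod_ge_0 z). pose proof (Cmod_ge_0 (f z)).
  set (y := Cmod (tau - f z)) in *. set (x := Cmod (tau - z)) in *.
  assert (F1 : 1 - Cmod (f z) ^ 2 <= 2 * y) by nra.
  assert (F2 : x ^ 2 / (1 - Cmod z ^ 2) <= M * x).
  { apply Rmult_le_reg_r with (1 - Cmod z ^ 2); [exact Pz|].
    unfold Rdiv. rewrite Rmult_assoc, Rinv_l, Rmult_1_r by lra.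
    replace (M * x * (1 - Cmod z ^ 2)) with (x * (M * (1 - Cmod z)) * (1 + Cmod z)) by ring.
    assert (x * x <= x * (M * (1 - Cmod z))) by (apply Rmult_le_compat_l; lra). nra. }
  assert (F3 : y ^ 2 <= M * x * (1 - Cmod (f z) ^ 2)).
  { apply Rmult_le_reg_r with (/ (1 - Cmod (f z) ^ 2)); [now apply Rinv_0_lt_compat|].
    rewrite (Rmult_assoc (M * x)), Rinv_r by lra. unfold Rdiv in *. lra. }
  assert (F4 : y ^ 2 <= M * x * (2 * y)).
  { eapply Rle_trans; [exact F3|]. apply Rmult_le_compat_l; [apply Rmult_le_pos; lra | exact F1]. }
  apply Rmult_le_reg_r with y; lra.
Qed.

Lemma is_angular_lim_intro (f : C -> C) (tau l : C) :
  (forall M, 1 < M -> forall eps, 0 < eps -> exists eta, 0 < eta /\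
    forall z, stolz_region tau M z -> Cmod (z - tau) < eta -> Cmod (f z - l) < eps) ->
  is_angular_lim f tau l.
Proof.
  intros H M HM P HP. apply locally_Cmod in HP. destruct HP as [eps [He HP]].
  destruct (H M HM eps He) as [eta [Heta Hz]].
  unfold filtermap, within. apply locally_Cmod. exists eta. split; [exact Heta|].
  intros z Hd Hs. apply HP, Hz; assumption.
Qed.

(* psi = P o f - P has nonnegative real part, which is small compared with Re P
   at suitable points of the zero-step orbit; by Harnack psi = o(P) in Stolz
   regions. *)
Lemma zero_step_angular_derive (f : C -> C) (b tau : C) :
  disc_map f -> zero_step f b -> Cmod tau = 1 ->
  (forall w, Cmod w < 1 -> horo tau (f w) <= horo tau w) ->
  is_angular_derive f tau 1.
Proof.
  intros Hf Hs T Hh. exists tau. split; apply is_angular_lim_intro; intros M HM eps He.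
  { exists (eps / (2 * M)). split; [apply Rdiv_lt_0_compat; lra|]. intros z [Hz HS] Hd.
    rewrite Cmod_minus_sym.
    eapply Rle_lt_trans; [apply horo_stolz_bound with (M := M); auto; lra|].
    rewrite Cmod_minus_sym. apply Rmult_lt_compat_l with (r := 2 * M) in Hd; [|lra].
    replace (2 * M * (eps / (2 * M))) with eps in Hd by (field; lra). exact Hd. }
  (* Makes the main term M * (32 * k0 * M) at the end equal to eps / 2. *)
  set (k0 := eps / (64 * M ^ 2)).
  assert (M2 : 0 < M ^ 2) by (apply pow_lt; lra).
  assert (Hk0 : 0 < k0) by (apply Rdiv_lt_0_compat; lra).
  (* Ensures (1 + p) / (1 - p) <= 1 + k0 for p < e0, so that Harnack for P between a and f a gives
     [Step]. *)
  set (e0 := Rmin (/ 2) (k0 / 4)). assert (He0 : 0 < e0) by (apply Rmin_pos; lra).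
  pose proof (Rmin_l (/ 2) (k0 / 4)) as e1. pose proof (Rmin_r (/ 2) (k0 / 4)) as e2. fold e0 in e1, e2.
  destruct (zero_step_small f b Hf Hs e0 He0) as [N HN]. specialize (HN N (Nat.le_refl N)).
  pose proof (disc_map_iter_lt_1 f N b Hf (proj1 Hs)) as Ha.
  set (a := Nat.iter N f b) in *. pose proof (proj1 Hf a Ha) as Hfa.
  pose proof (Re_poisson_pos tau a T Ha) as Pa. set (A := Re (poisson tau a)) in *.
  assert (Step : Re (poisson tau (f a)) <= A + k0 * A).
  { pose proof (harnack (poisson tau) a (f a) (fun w => diff_at_poisson tau w T)
        (fun w => Re_poisson_pos tau w T) Ha Hfa) as K. fold A in K.
    pose proof (re_le_Cmod (poisson tau (f a) - Ci * RtoC (Im (poisson tau a)))) as RC.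
    assert (ER : Re (poisson tau (f a) - Ci * RtoC (Im (poisson tau a))) = Re (poisson tau (f a))).
    { destruct (poisson tau (f a)). simpl. ring. }
    rewrite ER in RC. pose proof (Rle_abs (Re (poisson tau (f a)))).
    pose proof (pd_ge_0 (f a) a) as p0. set (p := pd (f a) a) in *.
    set (X := Cmod (poisson tau (f a) - Ci * RtoC (Im (poisson tau a)))) in *.
    apply Rle_trans with X; [lra|].
    apply Rmult_le_reg_r with (1 - p); [lra|]. eapply Rle_trans; [exact K|].
    replace ((A + k0 * A) * (1 - p)) with (A * ((1 + k0) * (1 - p))) by ring.
    apply Rmult_le_compat_l; [lra|]. nra. }
  (* The shift by kap makes the real part of psi strictly positive, as [harnack] requires, and is no
     larger than the bound on the increment at a, so Re (psi a) <= 2 * k0 * A. *)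
  set (kap := k0 * A). assert (Hkap : 0 < kap) by now apply Rmult_lt_0_compat.
  set (psi0 := fun w => (poisson tau (f w) - poisson tau w)%C).
  set (psi := fun w => (psi0 w + RtoC kap)%C).
  assert (D0 : forall w, Cmod w < 1 -> diff_at psi0 w).
  { intros w Hw. apply diff_at_minus; [|now apply diff_at_poisson].
    apply diff_at_comp; [now apply Hf|]. apply diff_at_poisson; [exact T | now apply Hf]. }
  assert (Rpsi : forall w, Re (psi w) = Re (poisson tau (f w)) - Re (poisson tau w) + kap).
  { intros w. unfold psi, psi0. destruct (poisson tau (f w)), (poisson tau w). simpl. ring. }
  assert (Ppsi : forall w, Cmod w < 1 -> 0 < Re (psi w)).
  { intros w Hw. rewrite Rpsi.
    assert (Re (poisson tau w) <= Re (poisson tau (f w))); [|lra].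
    rewrite !Re_poisson_horo by (auto; now apply Hf).
    apply Rinv_le_contravar; [|now apply Hh].
    apply Rdiv_lt_0_compat; [apply pow_lt, Cmod_gt_0, boundary_neq; auto; now apply Hf|].
    apply one_minus_sq_pos. now apply Hf. }
  set (I0 := Cmod (Ci * RtoC (Im (psi a)))).
  assert (HI0 : 0 <= I0) by apply Cmod_ge_0.
  assert (Pta : 0 < Cmod (tau - a)) by now apply Cmod_gt_0, boundary_neq.
  (* The first bound puts z closer to tau than a is; the second makes the terms I0 + kap, constant
     in z, negligible after multiplication by |tau - z|. *)
  set (eta := Rmin (Cmod (tau - a)) (eps / (4 * M * (I0 + kap)))).
  assert (Hd0 : 0 < 4 * M * (I0 + kap)) by (apply Rmult_lt_0_compat; lra).
  exists eta. split; [apply Rmin_pos; [exact Pta | now apply Rdiv_lt_0_compat]|].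
  intros z [Hz HS] Hd. unfold unit_disc in Hz. rewrite Cmod_minus_sym in Hd.
  pose proof (Rmin_l (Cmod (tau - a)) (eps / (4 * M * (I0 + kap)))) as m1.
  pose proof (Rmin_r (Cmod (tau - a)) (eps / (4 * M * (I0 + kap)))) as m2. fold eta in m1, m2.
  pose proof (boundary_neq tau z T Hz) as Nz. pose proof (proj1 Hf z Hz) as Hfz.
  pose proof (boundary_neq tau (f z) T Hfz) as Nfz.
  assert (Nt : (tau <> 0)%C) by (apply Cmod_gt_0; lra).
  (* From P (f z) - P z = 2 tau (f z - z) / ((tau - f z)(tau - z)). *)
  assert (E : ((f z - tau) / (z - tau) - 1 = - (psi0 z * (tau - f z)) / (2 * tau))%C).
  { unfold psi0, poisson. field. repeat split; auto.
    intros h. apply Nz. replace (tau - z)%C with (- (z - tau))%C by ring. rewrite h. ring. }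
  rewrite E, Cmod_div, Cmod_opp, !Cmod_mult, Cmod_R, Rabs_pos_eq, T
    by (lra || (apply Cmult_neq_0; [intros h; apply RtoC_inj in h; lra | exact Nt])).
  pose proof (horo_stolz_bound f tau z M Hf T Hh Hz ltac:(lra) HS) as SB.
  pose proof (harnack psi a z) as K.
  assert (Dpsi : forall w, Cmod w < 1 -> diff_at psi w).
  { intros w Hw. apply diff_at_plus; [auto | apply diff_at_const]. }
  specialize (K Dpsi Ppsi Ha Hz).
  assert (Pza : 0 < Cmod (tau - z)) by now apply Cmod_gt_0.
  set (x := Cmod (tau - z)) in *.
  assert (Ra : Re (psi a) <= 2 * (k0 * A)) by (rewrite Rpsi; fold A; unfold kap; lra).
  set (X := Cmod (psi z - Ci * RtoC (Im (psi a)))) in *.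
  assert (X0 : 0 <= X) by apply Cmod_ge_0.
  pose proof (Ppsi a Ha) as Pp.
  (* Harnack gives X * (1 - d^2) <= 8 * k0 * A, and z near tau gives A * (1 - |z|^2) <= 4 * (1 -
     d^2). The factor A cancels, so the bound does not depend on a. *)
  assert (XB : X * x <= 32 * k0 * M).
  { pose proof (pd_identity z a Hz Ha) as PI. pose proof (pd_lt_1 z a Hz Ha) as p1.
    pose proof (pd_ge_0 z a) as p0. set (d := pd z a) in *.
    assert (Bd : Cmod (1 - Cconj a * z) <= 2 * Cmod (tau - a)).
    { rewrite Cmod_den_sym. eapply Rle_trans; [apply (Cmod_den_dist z tau a); lra|].
      rewrite Cmod_den_boundary by exact T. rewrite (Cmod_minus_sym z tau). fold x. lra. }
    set (B := Cmod (1 - Cconj a * z)) in *.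
    assert (B0 : 0 <= B) by apply Cmod_ge_0.
    assert (B2 : B ^ 2 <= 4 * Cmod (tau - a) ^ 2) by nra.
    assert (EA : A * Cmod (tau - a) ^ 2 = 1 - Cmod a ^ 2).
    { unfold A. rewrite Re_poisson by assumption. field. lra. }
    assert (d2 : 0 < 1 - d ^ 2) by nra.
    assert (Zx : x <= M * (1 - Cmod z ^ 2)).
    { pose proof (Cmod_ge_0 z). nra. }
    pose proof (one_minus_sq_pos z Hz) as Qz.
    assert (Q1 : A * (1 - Cmod z ^ 2) <= 4 * (1 - d ^ 2)).
    { apply Rmult_le_reg_r with (Cmod (tau - a) ^ 2); [now apply pow_lt|].
      replace (A * (1 - Cmod z ^ 2) * Cmod (tau - a) ^ 2)
        with ((1 - Cmod z ^ 2) * (A * Cmod (tau - a) ^ 2)) by ring.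
      rewrite EA, <- PI. nra. }
    assert (Q2 : X * (1 - d ^ 2) <= 8 * (k0 * A)).
    { replace (X * (1 - d ^ 2)) with (X * (1 - d) * (1 + d)) by ring.
      apply Rle_trans with (Re (psi a) * (1 + d) * (1 + d)); [apply Rmult_le_compat_r; lra|].
      assert ((1 + d) * (1 + d) <= 4) by nra.
      assert (Re (psi a) * ((1 + d) * (1 + d)) <= (2 * (k0 * A)) * 4)
        by (apply Rmult_le_compat; nra).
      lra. }
    apply Rmult_le_reg_r with A; [exact Pa|].
    apply Rle_trans with (X * (M * (1 - Cmod z ^ 2)) * A).
    - apply Rmult_le_compat_r; [lra|]. apply Rmult_le_compat_l; lra.
    - replace (X * (M * (1 - Cmod z ^ 2)) * A) with (M * X * (A * (1 - Cmod z ^ 2))) by ring.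
      apply Rle_trans with (M * X * (4 * (1 - d ^ 2))).
      + apply Rmult_le_compat_l; [apply Rmult_le_pos; lra | exact Q1].
      + replace (M * X * (4 * (1 - d ^ 2))) with (4 * M * (X * (1 - d ^ 2))) by ring.
        replace (32 * k0 * M * A) with (4 * M * (8 * (k0 * A))) by ring.
        apply Rmult_le_compat_l; lra. }
  assert (PB : Cmod (psi0 z) <= X + I0 + kap).
  { replace (psi0 z) with ((psi z - Ci * RtoC (Im (psi a))) + Ci * RtoC (Im (psi a)) + - RtoC kap)%C
      by (unfold psi; ring).
    eapply Rle_trans; [apply Cmod_triangle|]. rewrite Cmod_opp, Cmod_R, Rabs_pos_eq by lra.
    apply Rplus_le_compat_r. apply Cmod_triangle. }
  assert (Y0 : 0 <= Cmod (tau - f z)) by apply Cmod_ge_0.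
  apply Rle_lt_trans with ((X + I0 + kap) * (2 * M * x) / 2).
  { rewrite Rmult_1_r. apply Rmult_le_compat_r; [lra|].
    apply Rmult_le_compat; [apply Cmod_ge_0 | exact Y0 | exact PB | exact SB]. }
  replace ((X + I0 + kap) * (2 * M * x) / 2) with (M * (X * x) + M * (I0 + kap) * x) by field.
  assert (L1 : M * (X * x) <= eps / 2).
  { apply Rle_trans with (M * (32 * k0 * M)); [apply Rmult_le_compat_l; lra|].
    right. unfold k0. field. lra. }
  assert (L2 : M * (I0 + kap) * x < eps / 2).
  { apply Rlt_le_trans with (M * (I0 + kap) * (eps / (2 * (M * (I0 + kap))))).
    - apply Rmult_lt_compat_l; [apply Rmult_lt_0_compat; lra|].
      eapply Rlt_le_trans; [exact Hd|]. eapply Rle_trans; [exact m2|].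
      apply Rmult_le_compat_l; [lra|]. apply Rinv_le_contravar; nra.
    - right. field. split; nra. }
  lra.
Qed.

Lemma zero_step_parabolic (f : C -> C) (b : C) :
  disc_map f -> non_elliptic f -> zero_step f b -> parabolic f.
Proof.
  intros Hf Hne Hs. split; [exact Hne|].
  destruct (zero_step_horo_decr f b Hf Hne Hs) as [tau [T Hh]]. exists tau. split.
  - now apply zero_step_denjoy_wolff with (b := b).
  - now apply zero_step_angular_derive with (b := b).
Qed.

(** * The equivalence *)

(** Crude linear bounds for artanh, both from ln x <= x - 1; they suffice to transfer convergence to
    0. *)
Lemma hyp_dist_bounds (z w : C) : Cmod z < 1 -> Cmod w < 1 ->
  pd z w / 2 <= hyp_dist z w <= pd z w / (1 - pd z w).
Proof.
  intros Hz Hw. pose proof (pd_lt_1 z w Hz Hw). pose proof (pd_ge_0 z w).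
  unfold hyp_dist. fold (pd z w). cbv zeta. set (t := pd z w) in *.
  assert (L : forall x, 0 < x -> ln x <= x - 1).
  { intros x Hx. pose proof (exp_ineq1_le (ln x)) as E. rewrite exp_ln in E by exact Hx. lra. }
  assert (P : 0 < / (1 - t)) by (apply Rinv_0_lt_compat; lra).
  split.
  - rewrite ln_div by lra. pose proof (L (1 - t) ltac:(lra)).
    assert (0 <= ln (1 + t)) by (rewrite <- ln_1; apply ln_le; lra). lra.
  - pose proof (L ((1 + t) / (1 - t)) ltac:(apply Rdiv_lt_0_compat; lra)) as Q.
    replace ((1 + t) / (1 - t) - 1) with (2 * (t / (1 - t))) in Q by (field; lra). lra.
Qed.

Lemma zero_hyperbolic_step_iff (f : C -> C) : disc_map f ->
  zero_hyperbolic_step f <-> exists b, zero_step f b.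
Proof.
  intros Hf. unfold zero_hyperbolic_step. split; intros [b [Hb Hl]]; exists b; (split; [exact Hb|]).
  - intros eps He. apply is_lim_seq_spec in Hl.
    destruct (Hl (mkposreal (eps / 2) ltac:(lra))) as [N HN]. specialize (HN N (le_n N)). simpl in HN.
    exists N. rewrite <- Nat.iter_succ_r. simpl.
    pose proof (disc_map_iter_lt_1 f N b Hf Hb) as Z. pose proof (proj1 Hf _ Z) as Z'.
    rewrite pd_sym by assumption.
    destruct (hyp_dist_bounds _ _ Z Z') as [B _]. rewrite Rminus_0_r in HN.
    pose proof (Rle_abs (hyp_dist (Nat.iter N f b) (f (Nat.iter N f b)))). lra.
  - apply is_lim_seq_spec. intros eps. pose proof (cond_pos eps) as He.
    set (e := Rmin (/ 2) (eps / 4)).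
    pose proof (Rmin_l (/ 2) (eps / 4)) as m1. pose proof (Rmin_r (/ 2) (eps / 4)) as m2.
    fold e in m1, m2.
    destruct (zero_step_small f b Hf (conj Hb Hl) e) as [N HN]; [apply Rmin_pos; lra|].
    exists N. intros n Hn. specialize (HN n Hn). simpl. rewrite Rminus_0_r.
    pose proof (disc_map_iter_lt_1 f n b Hf Hb) as Z. pose proof (proj1 Hf _ Z) as Z'.
    rewrite pd_sym in HN by assumption.
    destruct (hyp_dist_bounds _ _ Z Z') as [B1 B2].
    pose proof (pd_ge_0 (Nat.iter n f b) (f (Nat.iter n f b))).
    set (t := pd (Nat.iter n f b) (f (Nat.iter n f b))) in *.
    rewrite Rabs_pos_eq by lra. eapply Rle_lt_trans; [exact B2|].
    apply Rmult_lt_reg_r with (1 - t); [lra|].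
    unfold Rdiv. rewrite Rmult_assoc, Rinv_l by lra. nra.
Qed.

Lemma Cmod_distortion_ratio (f : C -> C) (z : C) (n : nat) : disc_map f -> Cmod z < 1 ->
  Cmod (distortion_ratio f z n) * (1 - Cmod z ^ 2) = hyp_derive (Nat.iter n f) z.
Proof.
  intros Hf Hz. pose proof (one_minus_sq_pos _ (disc_map_iter_lt_1 f n z Hf Hz)) as P.
  unfold distortion_ratio, hyp_derive. rewrite Cmod_div, Cmod_R, Rabs_pos_eq.
  - field. lra.
  - lra.
  - intros h. apply RtoC_inj in h. lra.
Qed.

(** The factor 1 - |z|^2 between the two quantities does not depend on n, and monotonicity of the
    hyperbolic derivatives turns one small term into a limit. *)
Lemma distortion_ratio_lim (f : C -> C) (z : C) : disc_map f -> Cmod z < 1 ->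
  filterlim (distortion_ratio f z) eventually (locally (RtoC 0)) <-> hyp_derive_vanishes f z.
Proof.
  intros Hf Hz. pose proof (one_minus_sq_pos z Hz) as Pz. split.
  - intros H eps He.
    destruct (H (fun w => Cmod (w - 0)%C < eps)) as [N HN].
    { apply locally_Cmod. exists eps. auto. }
    exists N. specialize (HN N (le_n N)). cbv beta in HN.
    replace (distortion_ratio f z N - 0)%C with (distortion_ratio f z N) in HN by ring.
    rewrite <- Cmod_distortion_ratio by assumption.
    pose proof (Cmod_ge_0 (distortion_ratio f z N)). pose proof (pow2_ge_0 (Cmod z)). nra.
  - intros H P HP. apply locally_Cmod in HP. destruct HP as [eps [He HP]].
    destruct (H (eps * (1 - Cmod z ^ 2))) as [N HN]; [now apply Rmult_lt_0_compat|].
    exists N. intros n Hn. apply HP.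
    replace (distortion_ratio f z n - 0)%C with (distortion_ratio f z n) by ring.
    apply Rmult_lt_reg_r with (1 := Pz). rewrite Cmod_distortion_ratio by assumption.
    eapply Rle_lt_trans; [|exact HN]. now apply hyp_derive_iter_decr.
Qed.

Lemma hyp_derive_pos_iff (f : C -> C) (z : C) : disc_map f -> Cmod z < 1 ->
  0 < hyp_derive f z <-> C_derive f z <> RtoC 0.
Proof.
  intros Hf Hz. pose proof (one_minus_sq_pos z Hz) as P.
  pose proof (one_minus_sq_pos _ (proj1 Hf z Hz)) as Q. unfold hyp_derive. split.
  - intros H h. rewrite h, Cmod_0 in H. unfold Rdiv in H. rewrite !Rmult_0_l in H. lra.
  - intros H. apply Cmod_gt_0 in H. apply Rdiv_lt_0_compat; [|exact Q]. now apply Rmult_lt_0_compat.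
Qed.

Theorem proposition6p1 (phi : C -> C)
    (hphi : holomorphic_self_map phi) (hne : non_elliptic phi) :
  let cond1 := parabolic phi /\ zero_hyperbolic_step phi in
  let cond2 :=
    exists z0 : C, unit_disc z0 /\
      (forall n : nat, C_derive (Nat.iter n phi) z0 <> RtoC 0) /\
      filterlim (distortion_ratio phi z0) eventually (locally (RtoC 0)) in
  let cond3 :=
    forall z0 : C, unit_disc z0 ->
      filterlim (distortion_ratio phi z0) eventually (locally (RtoC 0)) in
  (cond1 <-> cond2) /\ (cond2 <-> cond3).
Proof.
  intros cond1 cond2 cond3.
  pose proof (holomorphic_disc_map phi hphi) as Hf.
  assert (H13 : cond1 -> cond3).
  { intros [_ Hs] w Hw. apply (zero_hyperbolic_step_iff phi Hf) in Hs. destruct Hs as [b [Hb Hm]].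
    apply distortion_ratio_lim; [exact Hf | exact Hw |].
    now apply zero_step_all_hyp_derive_vanish with (z := b). }
  assert (H32 : cond3 -> cond2).
  { intros H3. destruct (noncritical_orbit phi Hf hne) as [z [Hz Hpos]].
    exists z. split; [exact Hz|]. split; [|now apply H3].
    intros n. apply hyp_derive_pos_iff; [now apply disc_map_iter | exact Hz | apply Hpos]. }
  assert (H21 : cond2 -> cond1).
  { intros [z [Hz [Hd Hl]]]. apply distortion_ratio_lim in Hl; [|exact Hf | exact Hz].
    assert (Hs : zero_step phi z).
    { split; [exact Hz|]. apply hyp_derive_vanishes_zero_step; auto.
      intros n. apply hyp_derive_pos_iff; [now apply disc_map_iter | exact Hz | apply Hd]. }
    split; [now apply zero_step_parabolic with (b := z)|].
    apply zero_hyperbolic_step_iff; [exact Hf | now exists z]. }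
  tauto.
Qed.
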